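(* Suppose that $\mu=\otimes_{k\in\mathcal K}\mu_k$ is a product of $K$ independent univariate distributions of the form $\mu_k=\sum_{l\in\mathcal L}\mu_k^l\delta_{x_k^l}$, and that $\nu_t=t\delta_{\boldsymbol y_1}+(1-t)\delta_{\boldsymbol y_2}$ is a two-point distribution with $\boldsymbol y_1,\boldsymbol y_2\in\mathbb R^K$ and $t\in[0,1]$. If $c(\boldsymbol x,\boldsymbol y)=\|\boldsymbol x-\boldsymbol y\|^2$ and if the set $$\mathcal M=\{x_k^l(y_{1,k}-y_{2,k}) : k\in\mathcal K,\ l\in\mathcal L\}$$ spans a regular one-dimensional grid $\mathcal N$ with (known) cardinality $N$, then the optimal transport distance $W_c(\mu,\nu_t)$ can be computed exactly by a (dynamic programming-type) algorithm using $\mathcal O(KL\log_2(KL)+KLN+K^2N^2)$ arithmetic operations. Moreover, if all problem parameters (that is, all $x_k^l$, $\mu_k^l$, $y_{1,k}$, $y_{2,k}$ and $t$) are rational and representable as ratios of two integers with absolute values at most $U$, then the bit lengths of all numbers computed by this algorithm are polynomially bounded in $K$, $L$, $N$ and $\log_2(U)$.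
   Context: $\mathcal K=\{1,\dots,K\}$, $\mathcal L=\{1,\dots,L\}$; $x_k^l\in\mathbb R$ are the support points and $\mu_k^l\ge0$, $\sum_{l}\mu_k^l=1$, the probabilities of the $k$-th marginal $\mu_k$. $y_{j,k}$ is the $k$-th coordinate of $\boldsymbol y_j$. $\|\cdot\|$ is the Euclidean norm. The algorithm receives as input the numbers $x_k^l$, $\mu_k^l$ ($k\in\mathcal K$, $l\in\mathcal L$), the vectors $\boldsymbol y_1,\boldsymbol y_2$, the probability $t$ and the cardinality $N$. In particular, the (up to $L^K$) atoms of $\mu$ are not enumerated in the input. For discrete distributions $\mu=\sum_i\mu_i\delta_{\boldsymbol x_i}$ and $\nu=\sum_j\nu_j\delta_{\boldsymbol y_j}$ on $\mathbb R^K$, the optimal transport distance is $W_c(\mu,\nu)=\min_{\boldsymbol\pi}\sum_{i,j}c(\boldsymbol x_i,\boldsymbol y_j)\pi_{ij}$, with the minimum over all nonnegative matrices $\boldsymbol\pi$ with row sums $\mu_i$ and column sums $\nu_j$. A set $\mathcal N\subseteq\mathbb R$ is a one-dimensional regular grid with cardinality $N$ if there exist $\hat s_1,\dots,\hat s_N\in\mathbb R$ and a grid spacing constant $d>0$ such that $\hat s_{i+1}=\hat s_i+d$ for all $i=1,\dots,N-1$ and $\mathcal N=\{\hat s_1,\dots,\hat s_N\}$. A set $\mathcal M\subseteq\mathbb R$ spans the one-dimensional regular grid $\mathcal N$ if $\mathcal M\subseteq\mathcal N$, $\min\mathcal M=\min\mathcal N$ and $\max\mathcal M=\max\mathcal N$.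 Arithmetic operations (additions, subtractions, multiplications, divisions and comparisons) are counted at unit cost, irrespective of the bit lengths of the operands. *)

(* Defs.v *)
From HB Require Import structures.
From mathcomp Require Import all_boot all_order all_algebra.
From mathcomp Require Import classical_sets reals exp.

Set Implicit Arguments.
Unset Strict Implicit.
Unset Printing Implicit Defensive.

Import Order.TTheory GRing.Theory Num.Theory.

Local Open Scope ring_scope.
Local Open Scope classical_set_scope.

(* [DDist w a] stands for the finite sum of the [w i] times the Dirac mass at
   [a i]; the atoms need not be pairwise distinct. *)
Record ddist (R : realType) (T : Type) (I : finType) := DDist {
  weight : I -> R;
  atom : I -> T
}.

Definition is_prob (R : realType) (T : Type) (I : finType)
    (mu : ddist R T I) : Prop :=
  (forall i, 0 <= weight mu i) /\ \sum_i weight mu i = 1.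

Definition is_coupling (R : realType) (T : Type) (I J : finType)
    (mu : ddist R T I) (nu : ddist R T J) (p : I -> J -> R) : Prop :=
  [/\ forall i j, 0 <= p i j,
      forall i, \sum_j p i j = weight mu i
    & forall j, \sum_i p i j = weight nu j].

Definition transport_cost (R : realType) (T : Type) (I J : finType)
    (c : T -> T -> R) (mu : ddist R T I) (nu : ddist R T J)
    (p : I -> J -> R) : R :=
  \sum_i \sum_j c (atom mu i) (atom nu j) * p i j.

Definition is_min (R : realType) (S : set R) (w : R) : Prop :=
  S w /\ lbound S w.

Definition is_max (R : realType) (S : set R) (w : R) : Prop :=
  S w /\ ubound S w.

Definition is_ot_distance (R : realType) (T : Type) (I J : finType)
    (c : T -> T -> R) (mu : ddist R T I) (nu : ddist R T J) (w : R) : Prop :=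
  is_min [set transport_cost c mu nu p | p in is_coupling mu nu] w.

Definition marginal (R : realType) (K L : nat) (x mu : 'M[R]_(K, L))
    (k : 'I_K) : ddist R R 'I_L :=
  DDist (fun l => mu k l) (fun l => x k l).

Definition product_dist (R : realType) (K : nat) (I : finType)
    (m : 'I_K -> ddist R R I) : ddist R 'rV[R]_K {ffun 'I_K -> I} :=
  DDist (fun i : {ffun 'I_K -> I} => \prod_k weight (m k) (i k))
        (fun i : {ffun 'I_K -> I} => \row_k atom (m k) (i k)).

Definition two_point_dist (R : realType) (T : Type) (t : R) (y1 y2 : T) :
    ddist R T bool :=
  DDist (fun b : bool => if b then t else 1 - t)
        (fun b : bool => if b then y1 else y2).

(* The library norm `|x| on 'rV_K is the sup norm, hence this definition. *)
Definition euclidean_norm (R : realType) (K : nat) (x : 'rV[R]_K) : R :=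
  Num.sqrt (\sum_k x 0 k ^+ 2).

Definition sq_cost (R : realType) (K : nat) (x y : 'rV[R]_K) : R :=
  euclidean_norm (x - y) ^+ 2.

Definition regular_grid (R : realType) (N : nat) (G : set R) : Prop :=
  exists (s : 'I_N -> R) (d : R),
    [/\ 0 < d,
        forall i j : 'I_N, j = i.+1 :> nat -> s j = s i + d
      & G = range s].

Definition spans_grid (R : realType) (M G : set R) : Prop :=
  [/\ M `<=` G,
      exists m, is_min M m /\ is_min G m
    & exists m, is_max M m /\ is_max G m].

Definition projections (R : realType) (K L : nat) (x : 'M[R]_(K, L))
    (y1 y2 : 'rV[R]_K) : set R :=
  [set z | exists (k : 'I_K) (l : 'I_L), z = x k l * (y1 0 k - y2 0 k)].

(* A real random-access machine. Programs are finite syntax trees, so that one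
   program serves all input sizes. The memory consists of arrays (named by
   naturals, of unbounded length) of two kinds: index arrays, which hold
   naturals, and number arrays, which hold reals. Cells are addressed by
   index expressions only. Reals enter the control flow through comparisons
   only; there is no rounding and no conversion of reals to indices, and
   the only literals are naturals. *)

Inductive iexp : Type :=
| ILit of nat
| ILoad of nat & iexp
| IAdd of iexp & iexp
| ISub of iexp & iexp
| IMul of iexp & iexp.

Inductive nexp : Type :=
| NLit of nat
| NLoad of nat & iexp
| NAdd of nexp & nexp
| NSub of nexp & nexp
| NMul of nexp & nexp
| NDiv of nexp & nexp.

Inductive test : Type :=
| ILe of iexp & iexp
| ILt of iexp & iexp
| NLe of nexp & nexp
| NLt of nexp & nexp.

Inductive cmd : Type :=
| Skip
| ISet of nat & iexp & iexp
| NSet of nat & iexp & nexp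
| Seq of cmd & cmd
| If of test & cmd & cmd
| While of test & cmd.

Record state (R : realType) := State {
  imem : nat -> nat -> nat;
  nmem : nat -> nat -> R
}.

Definition upd (T : Type) (m : nat -> nat -> T) (a i : nat) (v : T) :
    nat -> nat -> T :=
  fun b j => if (b == a) && (j == i) then v else m b j.

(* The result of one arithmetic operation.  An execution produces the list of
   the results of all its additions, subtractions, multiplications, divisions
   and comparisons, on numbers and on indices alike; the length of this list is
   the number of operations, and its entries are the numbers computed. *)
Inductive result (R : realType) : Type :=
| Index of nat
| Number of R
| Truth of bool.

Arguments Index {R}.
Arguments Truth {R}.

(* Subtraction of indices is truncated at 0. *)
Fixpoint ieval (R : realType) (s : state R) (e : iexp) : nat * seq (result R) :=
  let binop (f : nat -> nat -> nat) e1 e2 :=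
    let: (m, tr1) := ieval s e1 in
    let: (n, tr2) := ieval s e2 in
    (f m n, tr1 ++ tr2 ++ [:: Index (f m n)]) in
  match e with
  | ILit n => (n, [::])
  | ILoad a e1 => let: (i, tr) := ieval s e1 in (imem s a i, tr)
  | IAdd e1 e2 => binop addn e1 e2
  | ISub e1 e2 => binop subn e1 e2
  | IMul e1 e2 => binop muln e1 e2
  end.

(* [None] signals a division by zero; a program that divides by zero has no
   execution. *)
Fixpoint neval (R : realType) (s : state R) (e : nexp) :
    option (R * seq (result R)) :=
  let binop (f : R -> R -> option R) e1 e2 :=
    if neval s e1 is Some (u, tr1) then
      if neval s e2 is Some (v, tr2) then
        if f u v is Some w then Some (w, tr1 ++ tr2 ++ [:: Number w]) else None
      else None
    else None in
  match e with
  | NLit n => Some (n%:R, [::])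
  | NLoad a e1 => let: (i, tr) := ieval s e1 in Some (nmem s a i, tr)
  | NAdd e1 e2 => binop (fun u v => Some (u + v)) e1 e2
  | NSub e1 e2 => binop (fun u v => Some (u - v)) e1 e2
  | NMul e1 e2 => binop (fun u v => Some (u * v)) e1 e2
  | NDiv e1 e2 => binop (fun u v => if v == 0 then None else Some (u / v)) e1 e2
  end.

Definition teval (R : realType) (s : state R) (b : test) :
    option (bool * seq (result R)) :=
  let itest (f : nat -> nat -> bool) e1 e2 :=
    let: (m, tr1) := ieval s e1 in
    let: (n, tr2) := ieval s e2 in
    Some (f m n, tr1 ++ tr2 ++ [:: Truth (f m n)]) in
  let ntest (f : R -> R -> bool) e1 e2 :=
    if neval s e1 is Some (u, tr1) then
      if neval s e2 is Some (v, tr2) then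
        Some (f u v, tr1 ++ tr2 ++ [:: Truth (f u v)])
      else None
    else None in
  match b with
  | ILe e1 e2 => itest (fun m n => m <= n)%N e1 e2
  | ILt e1 e2 => itest (fun m n => m < n)%N e1 e2
  | NLe e1 e2 => ntest (fun u v => u <= v) e1 e2
  | NLt e1 e2 => ntest (fun u v => u < v) e1 e2
  end.

(* [exec c s s' tr]: started in [s], the command [c] halts in [s'] and performs
   the operations with results [tr]. *)
Inductive exec (R : realType) :
    cmd -> state R -> state R -> seq (result R) -> Prop :=
| ExecSkip s :
    exec Skip s s [::]
| ExecISet s a e1 e2 i n tr1 tr2 :
    ieval s e1 = (i, tr1) -> ieval s e2 = (n, tr2) ->
    exec (ISet a e1 e2) s (State (upd (imem s) a i n) (nmem s)) (tr1 ++ tr2)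
| ExecNSet s a e1 e2 i u tr1 tr2 :
    ieval s e1 = (i, tr1) -> neval s e2 = Some (u, tr2) ->
    exec (NSet a e1 e2) s (State (imem s) (upd (nmem s) a i u)) (tr1 ++ tr2)
| ExecSeq c1 c2 s1 s2 s3 tr1 tr2 :
    exec c1 s1 s2 tr1 -> exec c2 s2 s3 tr2 ->
    exec (Seq c1 c2) s1 s3 (tr1 ++ tr2)
| ExecIf b c1 c2 s s' v tr1 tr2 :
    teval s b = Some (v, tr1) -> exec (if v then c1 else c2) s s' tr2 ->
    exec (If b c1 c2) s s' (tr1 ++ tr2)
| ExecWhileFalse b c s tr :
    teval s b = Some (false, tr) ->
    exec (While b c) s s tr
| ExecWhileTrue b c s1 s2 s3 tr1 tr2 tr3 :
    teval s1 b = Some (true, tr1) -> exec c s1 s2 tr2 ->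
    exec (While b c) s2 s3 tr3 ->
    exec (While b c) s1 s3 (tr1 ++ tr2 ++ tr3).

(* Matrices are stored row by row.  Nothing is assumed on the contents of the
   other memory cells. *)
Definition holds_input (R : realType) (K L N : nat) (x mu : 'M[R]_(K, L))
    (y1 y2 : 'rV[R]_K) (t : R) (s : state R) : Prop :=
  [/\ [/\ imem s 0 0 = K, imem s 0 1 = L & imem s 0 2 = N],
      forall (k : 'I_K) (l : 'I_L), nmem s 0 (k * L + l)%N = x k l,
      forall (k : 'I_K) (l : 'I_L), nmem s 1 (k * L + l)%N = mu k l,
      forall k : 'I_K, nmem s 2 k = y1 0 k /\ nmem s 3 k = y2 0 k
    & nmem s 4 0 = t].

Definition output (R : realType) (s : state R) : R := nmem s 5 0.

Definition log2 (R : realType) (u : R) : R := ln u / ln 2.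

(* The number of binary digits of n. *)
Definition nat_bits (n : nat) : nat := up_log 2 n.+1.

(* One sign bit, and the numerator and denominator in lowest terms. *)
Definition rat_bits (q : rat) : nat :=
  (1 + nat_bits `|numq q|%N + nat_bits `|denq q|%N)%N.

Definition result_bits_le (R : realType) (B : R) (r : result R) : Prop :=
  match r with
  | Index n => (nat_bits n)%:R <= B
  | Number u => exists q : rat, u = ratr q /\ (rat_bits q)%:R <= B
  | Truth _ => True
  end.

Fixpoint all_results (R : realType) (P : result R -> Prop)
    (tr : seq (result R)) : Prop :=
  if tr is r :: tr' then P r /\ all_results P tr' else True.

Definition ratio_of_ints_le (R : realType) (U : nat) (u : R) : Prop :=
  exists a b : int,
    [/\ b != 0, (`|a| <= U)%N, (`|b| <= U)%N & u = a%:~R / b%:~R].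

(* Main.v *)
Require Import Defs.
From HB Require Import structures.
From mathcomp Require Import all_boot all_order all_algebra.
From mathcomp Require Import classical_sets reals exp.
From mathcomp Require Import zify ring lra.

Set Implicit Arguments.
Unset Strict Implicit.
Unset Printing Implicit Defensive.

Import Order.TTheory GRing.Theory Num.Theory.

Local Open Scope ring_scope.
Local Open Scope classical_set_scope.

(** Since [|x - y2|^2 - |x - y1|^2 = |y2|^2 - |y1|^2 + 2 <x, y1 - y2>], a
    coupling is described by the share [a i] of each atom that goes to [y2], and
    its cost is a constant plus twice the sum of [a i] times the score
    [<x_i, y1 - y2>] ([split_cost]). The shares range over
    [0 <= a i <= prob i] with total [1 - t], so the optimum gives to [y2] the
    outcomes of lowest score ([greedy_optimal]), and only the law of the score
    matters. The score of an outcome is a sum of [K] grid points, hence it is one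
    of the [K * N] levels [K lo + j d]; its law is the [K]-fold convolution of
    the laws of the coordinates, which the table [conv] computes row by row.
    [conv_prob] identifies the last row with the law of the score: both are
    the coefficients of a product of generating polynomials.

    The grid itself is read off the data: its end points are the extreme
    projections [lo] and [hi], and the spacing is [(hi - lo) / (N - 1)]. A
    projection is located on the grid by comparing it with the [N] grid points,
    which costs [K * L * N] comparisons in all; the convolution costs
    [K * (K * N) * N] multiplications.

    The program is verified by stating what each loop has stored so far, in a
    big-step logic that also carries a budget of operations and a property of all
    results produced ([runs], [runs_for], [runs_algorithm]). That property is
    the source of the bound on the bit lengths: let [Q] be a common denominator
    of the data and of [1 / (N - 1)], and [M] a bound on the data and sizes.
    Sums and products of few factors keep [u * Q ^ c] integral and
    [|u| <= M ^ h] for small [c] and [h] ([rep]). Only the convolution multiplies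
    repeatedly, once per marginal, so [c] is [K + O(1)] and [h] is polynomial
    throughout; since [log Q] and [log M] are polynomial too ([common_scale]), so
    are the bit lengths ([ok_bits]). *)

(** * Executions with a budget *)

Section Runs.
Variables (R : realType) (P : result R -> Prop).

(** Termination of [c] within [n] operations, all results satisfying [P], in a
    state satisfying [Q]. *)
Definition runs (c : cmd) (s : state R) (n : nat) (Q : state R -> Prop) :=
  exists (s' : state R) (tr : seq (result R)),
    [/\ exec c s s' tr, (size tr <= n)%N, all_results P tr & Q s'].

Lemma all_results_cat (tr1 tr2 : seq (result R)) :
  all_results P tr1 -> all_results P tr2 -> all_results P (tr1 ++ tr2).
Proof. by elim: tr1 => [|r tr IH] //= [Pr Ptr] Ptr2; split; last exact: IH. Qed.

Lemma runs_le c s m n (Q : state R -> Prop) :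
  runs c s m Q -> (m <= n)%N -> runs c s n Q.
Proof.
move=> [s' [tr [H1 H2 H3 H4]]] mn; exists s', tr.
by split=> //; exact: leq_trans mn.
Qed.

Lemma runs_post c s n (Q Q' : state R -> Prop) :
  runs c s n Q -> (forall s', Q s' -> Q' s') -> runs c s n Q'.
Proof.
by move=> [s' [tr [H1 H2 H3 H4]]] QQ; exists s', tr; split=> //; exact: QQ.
Qed.

Lemma runs_skip s (Q : state R -> Prop) : Q s -> runs Skip s 0 Q.
Proof. by move=> Qs; exists s, [::]; split=> //; exact: ExecSkip. Qed.

Lemma runs_iset im nm a e1 e2 i v tr1 tr2 n (Q : state R -> Prop) :
  ieval (State im nm) e1 = (i, tr1) -> ieval (State im nm) e2 = (v, tr2) ->
  all_results P (tr1 ++ tr2) -> (size (tr1 ++ tr2) <= n)%N ->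
  Q (State (upd im a i v) nm) ->
  runs (ISet a e1 e2) (State im nm) n Q.
Proof.
move=> E1 E2 Ptr ntr Qs; exists (State (upd im a i v) nm), (tr1 ++ tr2).
by split=> //; exact: ExecISet E1 E2.
Qed.

Lemma runs_nset im nm a e1 e2 i v tr1 tr2 n (Q : state R -> Prop) :
  ieval (State im nm) e1 = (i, tr1) ->
  neval (State im nm) e2 = Some (v, tr2) ->
  all_results P (tr1 ++ tr2) -> (size (tr1 ++ tr2) <= n)%N ->
  Q (State im (upd nm a i v)) ->
  runs (NSet a e1 e2) (State im nm) n Q.
Proof.
move=> E1 E2 Ptr ntr Qs; exists (State im (upd nm a i v)), (tr1 ++ tr2).
by split=> //; exact: ExecNSet E1 E2.
Qed.

Lemma runs_seq c1 c2 s n1 n2 (Q : state R -> Prop) :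
  runs c1 s n1 (fun s1 => runs c2 s1 n2 Q) -> runs (Seq c1 c2) s (n1 + n2) Q.
Proof.
move=> [s1 [tr1 [E1 S1 P1 [s2 [tr2 [E2 S2 P2 Qs]]]]]].
exists s2, (tr1 ++ tr2); split=> //; first exact: ExecSeq E1 E2.
  by rewrite size_cat leq_add.
exact: all_results_cat.
Qed.

Lemma runs_if b c1 c2 s v tr n (Q : state R -> Prop) :
  teval s b = Some (v, tr) -> all_results P tr ->
  (v -> runs c1 s n Q) -> (~~ v -> runs c2 s n Q) ->
  runs (If b c1 c2) s (size tr + n) Q.
Proof.
move=> E Ptr R1 R2.
have [s' [tr' [E' S' P' Qs]]] : runs (if v then c1 else c2) s n Q.
  by case: (v) R1 R2 => R1 R2; [exact: R1|exact: R2].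
exists s', (tr ++ tr'); split=> //; first exact: ExecIf E E'.
  by rewrite size_cat leq_add2l.
exact: all_results_cat.
Qed.

(** Storing the old value is no change, so a guarded assignment has one result
    state, whatever the outcome of the test. *)
Lemma upd_same (T : Type) (m : nat -> nat -> T) a i : upd m a i (m a i) = m.
Proof.
apply: boolp.funext => b; apply: boolp.funext => j; rewrite /upd.
by case: andP => [[/eqP -> /eqP ->]|].
Qed.

Lemma runs_guarded_nset im nm b a e c v tr tr2 n (Q : state R -> Prop) :
  teval (State im nm) b = Some (c, tr) ->
  neval (State im nm) e = Some (v, tr2) ->
  all_results P tr -> (c -> all_results P tr2) ->
  (size (tr ++ tr2) <= n)%N ->
  Q (State im (upd nm a 0 (if c then v else nm a 0%N))) ->
  runs (If b (NSet a (ILit 0) e) Skip) (State im nm) n Q.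
Proof.
move=> Eb Ee Ptr Ptr2 ntr Qs; apply: runs_le ntr; rewrite size_cat.
apply: runs_if Eb Ptr _ _ => [|/negbTE] c_val; rewrite c_val in Qs.
  by apply: runs_nset Ee _ _ Qs => //; exact: Ptr2.
apply: (@runs_le _ _ 0) => //; apply: runs_skip; rewrite upd_same in Qs.
exact: Qs.
Qed.

(** Cell 0 of the index array [v] is the counter, cell [j] of the index array [b]
    is the bound, read again before each pass. *)
Definition For (v b j : nat) (body : cmd) : cmd :=
  Seq (ISet v (ILit 0) (ILit 0))
    (While (ILt (ILoad v (ILit 0)) (ILoad b (ILit j)))
       (Seq body
          (ISet v (ILit 0) (IAdd (ILoad v (ILit 0)) (ILit 1))))).

(** Besides its body, each pass pays for a comparison and for the increment; the
    last [1] is the comparison that ends the loop. *)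
Lemma runs_for v b j body n c (I : nat -> state R -> Prop) s :
  b != v ->
  (forall b', P (Truth b')) ->
  (forall i, (i <= n)%N -> P (Index i)) ->
  (forall i s', I i s' -> imem s' b j = n) ->
  I 0%N (State (upd (imem s) v 0 0) (nmem s)) ->
  (forall i s', (i < n)%N -> imem s' v 0 = i -> I i s' ->
     runs body s' c (fun s'' => imem s'' v 0 = i /\
       I i.+1 (State (upd (imem s'') v 0 i.+1) (nmem s'')))) ->
  runs (For v b j body) s (n * (c + 2) + 1) (I n).
Proof.
move=> bv PT PI Ib I0 Istep; rewrite -[(_ + 1)%N]add0n; apply: runs_seq.
exists (State (upd (imem s) v 0 0) (nmem s)), [::]; split=> //.
  exact: (@ExecISet _ s v (ILit 0) (ILit 0) _ _ [::] [::] erefl erefl).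
suff loop k i s1 : (i + k = n)%N -> imem s1 v 0 = i -> I i s1 ->
    runs (While (ILt (ILoad v (ILit 0)) (ILoad b (ILit j)))
       (Seq body (ISet v (ILit 0) (IAdd (ILoad v (ILit 0)) (ILit 1)))))
      s1 (k * (c + 2) + 1) (I n).
  by apply: (loop _ 0%N) => //=; rewrite /upd !eqxx.
elim: k i s1 => [|k IHk] i s1 ikn vi Ii.
  exists s1, [:: Truth false]; split=> //; last by rewrite -ikn addn0.
  by apply: ExecWhileFalse; rewrite /= vi (Ib _ _ Ii) -ikn addn0 ltnn.
have ltin : (i < n)%N by lia.
have [s' [tr1 [E1 S1 P1 [v1 I1]]]] := Istep _ _ ltin vi Ii.
have [|||s2 [tr2 [E2 S2 P2 Qs]]] :=
    IHk i.+1 (State (upd (imem s') v 0 i.+1) (nmem s')) => //; first by lia.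
  by rewrite /= /upd !eqxx.
exists s2, ([:: Truth true] ++ (tr1 ++ ([::] ++ [:: Index i.+1])) ++ tr2).
split=> //.
- apply: ExecWhileTrue E2.
    by rewrite /= vi (Ib _ _ Ii) ltin.
  have E3 : ieval s' (IAdd (ILoad v (ILit 0)) (ILit 1)) =
      (i.+1, [:: Index i.+1]) by rewrite /= v1 addn1.
  exact: (ExecSeq E1 (ExecISet _ (erefl : ieval s' (ILit 0) = (0%N, [::])) E3)).
- rewrite !size_cat /=; lia.
- apply: all_results_cat; first by [].
  apply: all_results_cat => //; apply: all_results_cat => //=.
  by split=> //; apply: PI.
Qed.

End Runs.

(** * Sizes relative to a common denominator *)

Section Rep.
Variables (R : realType) (S : nat -> nat -> Prop).
Hypothesis S_gt : forall Q M, S Q M -> (0 < Q)%N /\ (1 < M)%N.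

(** [S] is the set of admissible pairs of a common denominator [Q] and a magnitude
    [M]. Quantifying over all of them lets the sizes of the computed numbers be
    derived once, from their formulas, also when the data are irrational and [S]
    is empty. *)
Definition rep (c h : nat) (u : R) : Prop := forall Q M, S Q M ->
  u * Q%:R ^+ c \is a Num.int /\ `|u| <= M%:R ^+ h.

Lemma rep_weaken c h c' h' u : rep c h u -> (c <= c')%N -> (h <= h')%N ->
  rep c' h' u.
Proof.
move=> r cc hh Q M SQM; have [iu bu] := r _ _ SQM; have [Q0 M1] := S_gt SQM.
split.
  by rewrite -(subnKC cc) exprD mulrA rpredM // -natrX natr_int.
by apply: le_trans bu _; rewrite ler_weXn2l // ler1n ltnW.
Qed.

Lemma rep_nat n h : (forall Q M, S Q M -> n <= M ^ h)%N -> rep 0 h n%:R.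
Proof.
move=> nM Q M SQM; rewrite expr0 mulr1 natr_int normr_nat -natrX ler_nat.
by split=> //; exact: nM SQM.
Qed.

Lemma rep0 c h : rep c h 0.
Proof. by move=> Q M _; rewrite mul0r normr0 exprn_ge0 //; split; rewrite ?rpred0. Qed.

Lemma rep_nat1 : rep 0 0 1.
Proof. by apply: (@rep_nat 1). Qed.

Lemma rep_add c1 h1 c2 h2 u v : rep c1 h1 u -> rep c2 h2 v ->
  rep (maxn c1 c2) (maxn h1 h2).+1 (u + v).
Proof.
move=> ru rv Q M SQM; have [_ M1] := S_gt SQM.
have [iu bu] := rep_weaken ru (leq_maxl c1 c2) (leq_maxl h1 h2) SQM.
have [iv bv] := rep_weaken rv (leq_maxr c1 c2) (leq_maxr h1 h2) SQM.
split; first by rewrite mulrDl rpredD.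
apply: (le_trans (ler_normD _ _)); apply: (le_trans (lerD bu bv)).
rewrite -mulr2n -[_ *+ 2]mulr_natl exprS ler_wpM2r ?exprn_ge0 // ler_nat //.
Qed.

Lemma rep_opp c h u : rep c h u -> rep c h (- u).
Proof. by move=> r Q M /r; rewrite mulNr rpredN normrN. Qed.

Lemma rep_sub c1 h1 c2 h2 u v : rep c1 h1 u -> rep c2 h2 v ->
  rep (maxn c1 c2) (maxn h1 h2).+1 (u - v).
Proof. by move=> ru rv; apply: rep_add => //; apply: rep_opp. Qed.

Lemma rep_mul c1 h1 c2 h2 u v : rep c1 h1 u -> rep c2 h2 v ->
  rep (c1 + c2) (h1 + h2) (u * v).
Proof.
move=> ru rv Q M SQM; have [iu bu] := ru _ _ SQM; have [iv bv] := rv _ _ SQM.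
split; first by rewrite exprD mulrACA rpredM.
by rewrite normrM exprD ler_pM.
Qed.

Lemma rep_sum c h n (P : pred nat) (f : nat -> R) :
  (forall Q M, S Q M -> n <= M)%N ->
  (forall i, (i < n)%N -> P i -> rep c h (f i)) ->
  rep c h.+1 (\sum_(i < n | P i) f i).
Proof.
move=> nM rf Q M SQM; split.
  by rewrite mulr_suml rpred_sum // => i Pi; have [] := rf _ (ltn_ord i) Pi _ _ SQM.
apply: (le_trans (ler_norm_sum _ _ _)).
apply: (@le_trans _ _ (\sum_(i < n) M%:R ^+ h)).
  rewrite big_mkcond; apply: ler_sum => i _; case: ifPn => [Pi|_].
    by have [] := rf _ (ltn_ord i) Pi _ _ SQM.
  by rewrite exprn_ge0.
rewrite sumr_const card_ord -[_ *+ n]mulr_natl exprS ler_wpM2r ?exprn_ge0 //.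
by rewrite ler_nat (nM _ _ SQM).
Qed.

Lemma rep_mulrn c h n u :
  (forall Q M, S Q M -> n <= M)%N -> rep c h u -> rep c h.+1 (u *+ n).
Proof.
move=> nM ru; have /= := @rep_sum c h n xpredT (fun=> u) nM (fun _ _ _ => ru).
by rewrite sumr_const card_ord.
Qed.

End Rep.

(** * Bit lengths of rational numbers *)

Lemma nat_bits_le n b : (n <= 2 ^ b)%N -> (nat_bits n <= b.+1)%N.
Proof.
move=> nb; apply: up_log_min => //; rewrite expnS.
have p0 : (0 < 2 ^ b)%N by rewrite expn_gt0.
by lia.
Qed.

(** In lowest terms the denominator divides [D] and the numerator divides
    [u * D], so both are at most what they are over the denominator [D]. *)
Lemma rat_bits_le (R : realType) (u : R) (D a b : nat) : (0 < D)%N ->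
  u * D%:R \is a Num.int -> `|u * D%:R| <= (2 ^ a)%:R -> (D <= 2 ^ b)%N ->
  exists q : rat, u = ratr q /\ (rat_bits q <= a + b + 3)%N.
Proof.
move=> D0 /intrP[m um] ma Db.
have Dr : D%:R != 0 :> R by rewrite pnatr_eq0 -lt0n.
have Dq : D%:R != 0 :> rat by rewrite pnatr_eq0 -lt0n.
pose q : rat := m%:~R / D%:R.
have uq : u = ratr q.
  by rewrite /q fmorph_div /= ratr_int ratr_nat -um mulfK.
have nd : numq q * D%:Z = m * denq q.
  apply: (@intr_inj rat); rewrite !intrM.
  have : (numq q)%:~R = q * (denq q)%:~R by rewrite numqE.
  by move=> ->; rewrite /q -pmulrn mulrAC divfK.
have {nd} ndn : (`|numq q| * D = `|m| * `|denq q|)%N.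
  by rewrite -[D]/(`|D%:Z|)%N -!abszM nd.
have cop := coprime_num_den q.
have dD : (`|denq q| %| D)%N.
  rewrite -(@Gauss_dvdr _ `|numq q|) ?ndn ?dvdn_mull //.
  by rewrite coprime_sym.
have nm : (`|numq q| %| `|m|)%N.
  by rewrite -(@Gauss_dvdl _ _ `|denq q|) // -ndn dvdn_mulr.
have dle : (`|denq q| <= D)%N by apply: dvdn_leq.
have mle : (`|m| <= 2 ^ a)%N.
  by move: ma; rewrite um -intr_norm -abszE -pmulrn ler_nat.
have nle : (`|numq q| <= 2 ^ a)%N.
  apply: leq_trans mle; have [m0|m0] := eqVneq m 0; last first.
    by apply: dvdn_leq nm; rewrite absz_gt0.
  have am : `|m|%N = 0%N by rewrite m0.
  move/eqP: ndn; rewrite am mul0n muln_eq0 (gtn_eqF D0) orbF.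
  by move/eqP ->.
exists q; split=> //; rewrite /rat_bits.
have := nat_bits_le nle; have := nat_bits_le (leq_trans dle Db); lia.
Qed.

Lemma ratio_denominator (R : realType) (U : nat) (u : R) :
  ratio_of_ints_le U u ->
  exists b : nat, [/\ (0 < b)%N, (b <= U)%N & u * b%:R \is a Num.int].
Proof.
move=> [a [b [b0 _ bU ->]]]; exists `|b|%N; split=> //; first by rewrite absz_gt0.
rewrite pmulrn abszE intr_norm.
have br : b%:~R != 0 :> R by rewrite intr_eq0.
case: (ger0P (b%:~R : R)) => _; first by rewrite divfK // intr_int.
by rewrite mulrN divfK // rpredN intr_int.
Qed.

Lemma ratio_norm (R : realType) (U : nat) (u : R) :
  ratio_of_ints_le U u -> `|u| <= U%:R.
Proof.
move=> [a [b [b0 aU _ ->]]]; rewrite normrM normfV -!intr_norm.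
rewrite ler_pdivrMr ?ltr0z ?normr_gt0 //.
have b1 : (1 <= `|b|%N)%N by rewrite absz_gt0.
apply: (@le_trans _ _ (U%:R * 1)); last first.
  by rewrite ler_wpM2l // -abszE -pmulrn ler1n.
by rewrite mulr1 -abszE -pmulrn ler_nat.
Qed.

Lemma common_denominator (R : realType) (I : finType) (f : I -> R) (U : nat) :
  (forall i, ratio_of_ints_le U (f i)) ->
  exists Q : nat, [/\ (0 < Q)%N, (Q <= U ^ #|I|)%N
    & forall i, f i * Q%:R \is a Num.int].
Proof.
move=> fU; have [b hb] := fin_all_exists (fun i => ratio_denominator (fU i)).
exists (\prod_i b i)%N; split.
- by apply: prodn_gt0 => i; have [] := hb i.
- rewrite -prod_nat_const; apply: leq_prod => i _; by have [] := hb i.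
- move=> i; rewrite (bigD1 i) //= natrM mulrA rpredM ?natr_int //.
  by have [] := hb i.
Qed.

Lemma up_log_log2 (R : realType) (U : nat) : (0 < U)%N ->
  (up_log 2 U)%:R <= log2 U%:R + 1 :> R.
Proof.
move=> U0; have l2 : 0 < ln 2 :> R by rewrite ln_gt0 // ltr1n.
have [U1|U1] := ltnP 1 U; last first.
  have -> : U = 1%N by lia.
  by rewrite up_log1 /log2 ln1 mul0r add0r.
have /andP[lt _] := up_log_bounds (ltnSn 1) U1.
have u0 : (0 < up_log 2 U)%N by rewrite up_log_gt0.
rewrite -(prednK u0) -natr1 lerD2r /log2 ler_pdivlMr //.
rewrite mulr_natl -lnXn // -natrX ler_ln ?posrE ?ltr0n ?expn_gt0 //.
by rewrite ler_nat ltnW.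
Qed.

Lemma log2_ge0 (R : realType) (n : nat) : (0 < n)%N -> 0 <= log2 n%:R :> R.
Proof.
by move=> n0; rewrite divr_ge0 // ln_ge0 // ler1n.
Qed.

(** * The program *)

(** The scalar variables of the program occupy cell 0 of their array. Of the
    remaining arrays, index array 0 and number arrays 0 to 4 are the input; number
    array 12 holds the law of the current coordinate on the grid, and number array
    13 the convolution table, whose row [k] starts at cell [k * (K * N)]. *)
Local Notation ivar a := (ILoad a (ILit 0)).
Local Notation nvar a := (NLoad a (ILit 0)).

Local Notation lenK := (ILoad 0 (ILit 0)).
Local Notation lenL := (ILoad 0 (ILit 1)).
Local Notation lenN := (ILoad 0 (ILit 2)).
Local Notation vark := (ivar 1).
Local Notation varl := (ivar 2).
Local Notation varn := (ivar 3).
Local Notation varj := (ivar 4).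
Local Notation lenJ := (ivar 5).
Local Notation addr := (ivar 6).
Local Notation out := (nvar 5).
Local Notation low := (nvar 6).
Local Notation high := (nvar 7).
Local Notation count := (nvar 8).
Local Notation step := (nvar 9).
Local Notation gridpt := (nvar 10).
Local Notation accu := (nvar 11).
Local Notation levelv := (nvar 14).
Local Notation restv := (nvar 15).
Local Notation proj := (nvar 16).
Local Notation fillv := (nvar 17).
Local Notation iset a e := (ISet a (ILit 0) e).
Local Notation nset a e := (NSet a (ILit 0) e).
Local Notation "c1 ;; c2" := (Seq c1 c2) (at level 90, right associativity).

Definition set_addr : cmd := iset 6 (IAdd (IMul vark lenL) varl).

Definition proj_exp : nexp :=
  NMul (NLoad 0 addr) (NSub (NLoad 2 vark) (NLoad 3 vark)).

(** Summed over all [k] and [l], this is the constant part of the transport cost;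
    the factor [1 - t] may be put inside since the weights of a marginal sum to
    1. *)
Definition base_exp : nexp :=
  NMul (NLoad 1 addr)
    (NAdd (NMul (NSub (NLoad 0 addr) (NLoad 2 vark))
                (NSub (NLoad 0 addr) (NLoad 2 vark)))
          (NMul (NSub (NLit 1) (nvar 4))
                (NSub (NMul (NLoad 3 vark) (NLoad 3 vark))
                      (NMul (NLoad 2 vark) (NLoad 2 vark))))).

Definition prepare : cmd :=
  iset 5 (IMul lenK lenN) ;; iset 1 (ILit 0) ;; iset 6 (ILit 0) ;;
  nset 5 (NLit 0) ;; nset 6 proj_exp ;; nset 7 low.

Definition scan : cmd :=
  For 1 0 0 (For 2 0 1 (
    set_addr ;; nset 16 proj_exp ;;
    If (NLt proj low) (nset 6 proj) Skip ;;
    If (NLt high proj) (nset 7 proj) Skip ;;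
    nset 5 (NAdd out base_exp))).

(** Indices cannot be converted to numbers, hence the loop that counts to [N]. The
    test keeps a one-point grid from dividing by zero. *)
Definition find_step : cmd :=
  nset 8 (NLit 0) ;; For 3 0 2 (nset 8 (NAdd count (NLit 1))) ;;
  nset 9 (NSub high low) ;;
  If (NLt (NLit 1) count) (nset 9 (NDiv step (NSub count (NLit 1)))) Skip.

Definition start : cmd :=
  For 4 5 0 (NSet 13 varj (NLit 0)) ;; nset 13 (NLit 1) ;; nset 14 (NLit 0).

Definition collect : cmd :=
  nset 10 low ;;
  For 3 0 2 (
    nset 11 (NLit 0) ;;
    For 2 0 1 (
      set_addr ;; nset 16 proj_exp ;;
      If (NLe proj gridpt)
        (If (NLe gridpt proj) (nset 11 (NAdd accu (NLoad 1 addr))) Skip)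
        Skip) ;;
    NSet 12 varn accu ;;
    nset 10 (NAdd gridpt step)).

(** Subtraction of indices is truncated, hence the test [n <= j]. *)
Definition convolve : cmd :=
  For 4 5 0 (
    nset 11 (NLit 0) ;;
    For 3 0 2 (
      If (ILe varn varj)
        (nset 11 (NAdd accu (NMul (NLoad 12 varn)
           (NLoad 13 (IAdd (IMul vark lenJ) (ISub varj varn))))))
        Skip) ;;
    NSet 13 (IAdd (IMul (IAdd vark (ILit 1)) lenJ) varj) accu).

Definition distribution : cmd :=
  For 1 0 0 (collect ;; convolve ;; nset 14 (NAdd levelv low)).

Definition greedy : cmd :=
  nset 15 (NSub (NLit 1) (nvar 4)) ;;
  For 4 5 0 (
    nset 17 (NLoad 13 (IAdd (IMul lenK lenJ) varj)) ;;
    If (NLt restv fillv) (nset 17 restv) Skip ;;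
    nset 5 (NAdd out (NMul fillv (NAdd levelv levelv))) ;;
    nset 15 (NSub restv fillv) ;;
    nset 14 (NAdd levelv step)).

Definition algorithm : cmd :=
  prepare ;; scan ;; find_step ;; start ;; distribution ;; greedy.

(** * The computed values and their sizes *)

Lemma big_ord_recr_cond (V : nmodType) n (P : pred nat) (F : nat -> V) :
  \sum_(i < n.+1 | P i) F i =
  \sum_(i < n | P i) F i + (if P n then F n else 0).
Proof. by rewrite big_mkcond big_ord_recr -big_mkcond. Qed.

Section Values.
Variables (R : realType) (K L N : nat) (X Mu Y1 Y2 : nat -> R) (t lo hi : R).

Definition projection (k l : nat) : R := X (k * L + l)%N * (Y1 k - Y2 k).

Definition base_term (k l : nat) : R :=
  Mu (k * L + l)%N *
    ((X (k * L + l)%N - Y1 k) * (X (k * L + l)%N - Y1 k)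
     + (1 - t) * (Y2 k * Y2 k - Y1 k * Y1 k)).

Definition spacing : R :=
  if (1 < N)%N then (hi - lo) / (N%:R - 1) else hi - lo.

Definition grid (n : nat) : R := lo + spacing *+ n.

Definition mass (k n : nat) : R :=
  \sum_(l < L | projection k l == grid n) Mu (k * L + l)%N.

(** [conv k j] is the probability that the first [k] coordinates contribute
    [k * lo + j * spacing] to the score. *)
Fixpoint conv (k j : nat) : R :=
  if k is k'.+1 then \sum_(n < N | (n <= j)%N) mass k' n * conv k' (j - n)
  else (j == 0%N)%:R.

Definition level (j : nat) : R := lo *+ K + spacing *+ j.

(** The mass of [y2] that is still unassigned when the levels below [j] have been
    filled up. *)
Fixpoint rest (j : nat) : R :=
  if j is j'.+1 then rest j' - Num.min (rest j') (conv K j') else 1 - t.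

Definition fill (j : nat) : R := Num.min (rest j) (conv K j).

Definition base_cost : R := \sum_(k < K) \sum_(l < L) base_term k l.

Definition value : R :=
  base_cost + \sum_(j < K * N) fill j * (level j + level j).

Hypotheses (K0 : (0 < K)%N) (L0 : (0 < L)%N) (N0 : (0 < N)%N).
Hypothesis lo_in :
  exists k l, [/\ (k < K)%N, (l < L)%N & lo = projection k l].
Hypothesis hi_in :
  exists k l, [/\ (k < K)%N, (l < L)%N & hi = projection k l].
Hypothesis lo_le :
  forall k l, (k < K)%N -> (l < L)%N -> lo <= projection k l.
Hypothesis hi_ge :
  forall k l, (k < K)%N -> (l < L)%N -> projection k l <= hi.

(** The other cells hold arbitrary reals, so no size is assigned to them. *)
Definition datum (u : R) : Prop :=
  (exists k l, [/\ (k < K)%N, (l < L)%N &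
     u = X (k * L + l)%N \/ u = Mu (k * L + l)%N])
  \/ (exists2 k, (k < K)%N & u = Y1 k \/ u = Y2 k) \/ u = t.

(** The divisibility clause makes the division by [N - 1] harmless. *)
Definition scale (Q M : nat) : Prop :=
  [/\ (0 < Q)%N /\ (1 < M)%N,
      (K <= M /\ L <= M)%N, (N <= M /\ K * N <= M)%N,
      ((1 < N)%N -> (N.-1 %| Q)%N)
    & forall u, datum u -> u * Q%:R \is a Num.int /\ `|u| <= M%:R].

Lemma scale_gt Q M : scale Q M -> (0 < Q)%N /\ (1 < M)%N.
Proof. by case. Qed.

Local Notation repr := (@rep R scale).

Lemma rep_w c h c' h' u : repr c h u -> (c <= c')%N -> (h <= h')%N ->
  repr c' h' u.
Proof. exact: (rep_weaken (@scale_gt)). Qed.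

Lemma rep_datum u : datum u -> repr 1 1 u.
Proof. by move=> du Q M [_ _ _ _ /(_ _ du)]; rewrite !expr1. Qed.

Lemma rep_x k l : (k < K)%N -> (l < L)%N -> repr 1 1 (X (k * L + l)%N).
Proof. by move=> kK lL; apply: rep_datum; left; exists k, l; split=> //; left. Qed.

Lemma rep_mu k l : (k < K)%N -> (l < L)%N -> repr 1 1 (Mu (k * L + l)%N).
Proof. by move=> kK lL; apply: rep_datum; left; exists k, l; split=> //; right. Qed.

Lemma rep_y1 k : (k < K)%N -> repr 1 1 (Y1 k).
Proof. by move=> kK; apply: rep_datum; right; left; exists k => //; left. Qed.

Lemma rep_y2 k : (k < K)%N -> repr 1 1 (Y2 k).
Proof. by move=> kK; apply: rep_datum; right; left; exists k => //; right. Qed.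

Lemma rep_t : repr 1 1 t.
Proof. by apply: rep_datum; right; right. Qed.

Lemma rep_1 : repr 0 0 1.
Proof. exact: rep_nat1. Qed.

Definition rep_D := @rep_add R scale (@scale_gt).
Definition rep_B := @rep_sub R scale (@scale_gt).
Definition rep_M := @rep_mul R scale.

Ltac rep_solve :=
  lazymatch goal with
  | |- @rep _ _ _ _ (_ + - _) => apply: rep_B; rep_solve
  | |- @rep _ _ _ _ (_ + _) => apply: rep_D; rep_solve
  | |- @rep _ _ _ _ (_ / _) => eassumption
  | |- @rep _ _ _ _ (_ * _) => apply: rep_M; rep_solve
  | |- @rep _ _ _ _ 1 => apply: rep_1
  | |- _ => first [ eassumption | exact: rep_1
                  | solve [eauto using rep_x, rep_mu, rep_y1, rep_y2, rep_t] ]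
  end.
Ltac rep_auto := apply: rep_w; [rep_solve | lia | lia].

Lemma rep_projection k l : (k < K)%N -> (l < L)%N -> repr 2 3 (projection k l).
Proof. by move=> kK lL; rewrite /projection; rep_auto. Qed.

Lemma rep_base_term k l : (k < K)%N -> (l < L)%N -> repr 4 7 (base_term k l).
Proof. by move=> kK lL; rewrite /base_term; rep_auto. Qed.

Lemma rep_lo : repr 2 3 lo.
Proof. by have [k [l [kK lL ->]]] := lo_in; apply: rep_projection. Qed.

Lemma rep_hi : repr 2 3 hi.
Proof. by have [k [l [kK lL ->]]] := hi_in; apply: rep_projection. Qed.

Lemma rep_count n : (n <= N)%N -> repr 0 1 n%:R.
Proof.
by move=> nN; apply: rep_nat => Q M [_ _ [NM _] _ _]; rewrite expn1 (leq_trans nN).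
Qed.

(** The factor [N - 1] of the denominator is absorbed by one more factor [Q], and
    dividing by it does not increase the magnitude. *)
Lemma rep_spacing : repr 3 4 spacing.
Proof.
have rhl : repr 2 4 (hi - lo) by have := (rep_lo, rep_hi) => -[? ?]; rep_auto.
rewrite /spacing; case: ifPn => N1; last exact: rep_w rhl _ _.
move=> Q M S; have [ihl bhl] := rhl _ _ S; have [_ _ _ /(_ N1) dQ _] := S.
have -> : N%:R - 1 = N.-1%:R :> R by rewrite -(prednK N0) -natr1 addrK.
have n0 : N.-1%:R != 0 :> R by rewrite pnatr_eq0; lia.
split.
  have -> : (hi - lo) / N.-1%:R * Q%:R ^+ 3 =
      ((hi - lo) * Q%:R ^+ 2) * (Q %/ N.-1)%:R.
    have -> : Q%:R = (Q %/ N.-1)%:R * N.-1%:R :> R by rewrite -natrM divnK.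
    by field.
  by rewrite rpredM // natr_int.
rewrite normrM normfV normr_nat; apply: le_trans bhl.
rewrite ler_pdivrMr ?ltr0n; last by lia.
by rewrite ler_peMr // ler1n; lia.
Qed.

Lemma rep_grid n : (n < N)%N -> repr 3 6 (grid n).
Proof.
move=> nN; have rl := rep_lo; have rs : repr 3 5 (spacing *+ n).
  apply: rep_mulrn rep_spacing => Q M [_ _ [NM _] _ _].
  exact: leq_trans (ltnW nN) NM.
by rewrite /grid; rep_auto.
Qed.

Lemma rep_level k j : (k <= K)%N -> (j <= K * N)%N ->
  repr 3 6 (lo *+ k + spacing *+ j).
Proof.
move=> kK jKN; have rl : repr 2 4 (lo *+ k).
  apply: rep_mulrn rep_lo => Q M [_ [KM _] _ _ _]; exact: leq_trans KM.
have rs : repr 3 5 (spacing *+ j).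
  apply: rep_mulrn rep_spacing => Q M [_ _ [_ NM] _ _]; exact: leq_trans NM.
by rep_auto.
Qed.

Lemma rep_mass_part k n m : (k < K)%N -> (m <= L)%N ->
  repr 1 2 (\sum_(l < m | projection k l == grid n) Mu (k * L + l)%N).
Proof.
move=> kK mL.
apply: (@rep_sum _ _ _ _ _ (fun l => projection k l == grid n)
  (fun l => Mu (k * L + l)%N)).
  by move=> Q M [_ [_ LM] _ _ _]; exact: leq_trans LM.
by move=> l lm _; apply: rep_mu => //; exact: leq_trans mL.
Qed.

Lemma rep_conv_part k j m : (k < K)%N -> (m <= N)%N ->
  (forall j, repr k (3 * k) (conv k j)) ->
  repr k.+1 (3 * k).+3 (\sum_(n < m | (n <= j)%N) mass k n * conv k (j - n)).
Proof.
move=> kK mN rc; apply: (@rep_sum _ _ _ _ _ (fun n => n <= j)%N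
    (fun n => mass k n * conv k (j - n))).
  by move=> Q M [_ _ [NM _] _ _]; exact: leq_trans NM.
move=> n _ _; have rm := rep_mass_part n kK (leqnn L).
have {}rc := rc (j - n)%N; rep_auto.
Qed.

(** Each convolution multiplies by one mass and sums [N] products: one more
    denominator and three more magnitudes. *)
Lemma rep_conv k j : (k <= K)%N -> repr k (3 * k) (conv k j).
Proof.
elim: k j => [|k IH] j kK /=.
  by case: (j == 0)%N; [exact: rep_1|exact: rep0].
have := @rep_conv_part k j N kK (leqnn N) (fun j => IH j (ltnW kK)).
by move=> r; apply: (rep_w r); lia.
Qed.

Lemma rep_min c h u v : repr c h u -> repr c h v -> repr c h (Num.min u v).
Proof. by rewrite /Num.min; case: ifP. Qed.

(** A comparison chooses between numbers already computed, so only the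
    subtractions contribute, one magnitude each. *)
Lemma rep_rest j : repr K (3 * K + 2 + j) (rest j).
Proof.
elim: j => [|j IH] /=.
  by have r1 := rep_1; have rt := rep_t; rep_auto.
have rc : repr K (3 * K + 2 + j) (conv K j).
  by apply: rep_w (@rep_conv K j (leqnn K)) _ _; lia.
have rm := rep_min IH rc; rep_auto.
Qed.

Lemma rep_fill j : repr K (3 * K + 2 + j) (fill j).
Proof.
apply: rep_min (rep_rest j) _.
by apply: rep_w (@rep_conv K j (leqnn K)) _ _; lia.
Qed.

Lemma rep_base_row k m : (k < K)%N -> (m <= L)%N ->
  repr 4 8 (\sum_(l < m) base_term k l).
Proof.
move=> kK mL; apply: (@rep_sum _ _ _ _ _ xpredT (base_term k)).
  by move=> Q M [_ [_ LM] _ _ _]; exact: leq_trans LM.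
by move=> l lm _; apply: rep_base_term => //; exact: leq_trans mL.
Qed.

Lemma rep_base_rows m : (m <= K)%N ->
  repr 4 9 (\sum_(k < m) \sum_(l < L) base_term k l).
Proof.
move=> mK.
apply: (@rep_sum _ _ _ _ _ xpredT (fun k => \sum_(l < L) base_term k l)).
  by move=> Q M [_ [KM _] _ _ _]; exact: leq_trans KM.
by move=> k km _; apply: rep_base_row => //; exact: leq_trans mK.
Qed.

Lemma rep_fills m : (m <= K * N)%N ->
  repr (K + 3) (3 * K + K * N + 10)
    (\sum_(j < m) fill j * (level j + level j)).
Proof.
move=> mJ; have := @rep_sum _ scale (K + 3) (3 * K + K * N + 9) m xpredT
  (fun j => fill j * (level j + level j)).
rewrite -addnS; apply.
  by move=> Q M [_ _ [_ NM] _ _]; exact: leq_trans NM.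
move=> j jm _; have rf := rep_fill j.
by have rl : repr 3 6 (level j) by [apply: rep_level => //; lia]; rep_auto.
Qed.

(** * Correctness of the program *)

(** The convolution table has [K + 1] rows of length [K * N]; the other terms cover
    the addresses of the input matrices and the counters. *)
Definition index_bound : nat := (K.+1 * (K * N) + K * L + L)%N.

(** Of the [K + 8] denominators, [K] come from the convolutions; of the
    magnitudes, [3 K] come from the convolutions and [K N] from the greedy
    steps. *)
Definition ok (r : result R) : Prop :=
  match r with
  | Index n => (n <= index_bound)%N
  | Number u => repr (K + 8) (4 * K + K * N + 20) u
  | Truth _ => True
  end.

Definition has_inputs (s : state R) : Prop :=
  [/\ [/\ imem s 0 0 = K, imem s 0 1 = L & imem s 0 2 = N],
      nmem s 0 =1 X, nmem s 1 =1 Mu,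
      nmem s 2 =1 Y1 /\ nmem s 3 =1 Y2
    & nmem s 4 0 = t].

Definition ready (s : state R) : Prop := has_inputs s /\ imem s 5 0 = (K * N)%N.

Lemma cell_bound k l : (k < K)%N -> (l < L)%N ->
  (k * L <= index_bound)%N /\ (k * L + l <= index_bound)%N.
Proof.
move=> kK lL; rewrite /index_bound.
have : (k * L <= K * L)%N by rewrite leq_mul2r ltnW ?orbT.
by move: (_.+1 * _)%N => u; lia.
Qed.

Lemma len_bound : (K * N <= index_bound)%N /\ (N <= index_bound)%N /\
  (K <= index_bound)%N /\ (L <= index_bound)%N.
Proof.
have KN : (K <= K * N)%N by rewrite leq_pmulr.
have NK : (N <= K * N)%N by rewrite leq_pmull.
rewrite /index_bound mulSn; move: (_ * (_ * _))%N => u; lia.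
Qed.

Lemma row_bound k j : (k <= K)%N -> (j < K * N)%N ->
  (k * (K * N) <= index_bound)%N /\ (k * (K * N) + j <= index_bound)%N.
Proof.
move=> kK jJ; rewrite /index_bound mulSn.
have : (k * (K * N) <= K * (K * N))%N by rewrite leq_mul2r kK orbT.
by move: (k * _)%N (K * (K * N))%N => u v; lia.
Qed.

Ltac rep_all := repeat match goal with
  | |- _ /\ _ => split
  | |- True => exact: I
  | |- @rep _ _ _ _ _ => rep_auto
  | |- is_true (_ <= index_bound)%N => assumption
  end.

(** These tactics execute one assignment. The value [v] is supplied in its
    mathematical form, so that the memory never accumulates unevaluated reads; [E]
    is the rewriting rule that replaces the cells read by their contents. *)
Ltac iput i v E := eapply (@runs_iset _ _ _ _ _ _ _ i v);
  [ rewrite /= /upd /= ?E; reflexivity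
  | rewrite /= /upd /= ?E; reflexivity
  | rewrite /= ?E | rewrite /=; apply: leqnn | ].

Ltac nput i v E := eapply (@runs_nset _ _ _ _ _ _ _ i v);
  [ rewrite /= /upd /= ?E; reflexivity
  | rewrite /= /upd /= ?E; reflexivity
  | rewrite /= | rewrite /=; apply: leqnn | ].

Ltac nguard v E := eapply (@runs_guarded_nset _ _ _ _ _ _ _ _ v);
  [ rewrite /= /upd /= ?E; reflexivity
  | rewrite /= /upd /= ?E; reflexivity
  | rewrite /= | rewrite /= | rewrite /=; apply: leqnn | ].

Lemma runs_prepare s : has_inputs s ->
  runs ok prepare s 10 (fun s' => [/\ ready s', nmem s' 5 0 = 0,
    nmem s' 6 0 = projection 0 0 & nmem s' 7 0 = projection 0 0]).
Proof.
case: s => im nm [[/= EK EL EN] EX EM [E1 E2] Et].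
have [bJ [bN [bK bL]]] := len_bound.
pose E := (EK, EL, EN, EX, EM, E1, E2, Et).
have [[rx r1] r2] := (rep_x K0 L0, rep_y1 K0, rep_y2 K0).
eapply runs_le.
apply: runs_seq; iput 0%N (K * N)%N E => //.
apply: runs_seq; iput 0%N 0%N E => //.
apply: runs_seq; iput 0%N 0%N E => //.
apply: runs_seq; nput 0%N (0 : R) E => //.
apply: runs_seq; nput 0%N (projection 0 0) E => //.
  by rep_all.
eapply runs_nset; [reflexivity|reflexivity|by []|exact: leqnn|].
  by rewrite /upd; split=> //=; split.
by rewrite !add0n.
Qed.

(** The state of the scan before the entry [(k, l)], in row by row order. *)
Definition scan_inv (k l : nat) (s : state R) : Prop :=
  [/\ ready s,
      exists k' l', [/\ (k' < K)%N, (l' < L)%N & nmem s 6 0 = projection k' l'],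
      exists k' l', [/\ (k' < K)%N, (l' < L)%N & nmem s 7 0 = projection k' l'],
      forall k' l', (k' < K)%N -> (l' < L)%N ->
        (k' < k)%N || (k' == k) && (l' < l)%N ->
        nmem s 6 0 <= projection k' l' <= nmem s 7 0
    & nmem s 5 0 = \sum_(k' < k) \sum_(l' < L) base_term k' l'
                   + \sum_(l' < l) base_term k l'].

Lemma runs_scan s : scan_inv 0 0 s ->
  runs ok scan s (K * ((L * (20 + 2) + 1) + 2) + 1) (scan_inv K 0).
Proof.
have [bJ [bN [bK bL]]] := len_bound.
move=> I0; apply: (runs_for (I := fun k => scan_inv k 0)) => //.
- by move=> i iK; apply: leq_trans bK.
- by move=> i s' [[[[]]]].
move=> k s' kK ck Ik.
apply: (@runs_post _ _ _ _ _
  (fun s => imem s 1 0 = k /\ scan_inv k L s)); last first.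
  move=> [im nm] [/= ik [rd lin hin le sm]]; split=> //; split=> //=.
    move=> k' l' k'K l'L /orP[|/andP[_ //]]; rewrite ltnS leq_eqVlt => kk.
    by apply: le => //; rewrite l'L andbT orbC.
  by rewrite big_ord0 addr0 big_ord_recr.
apply: (runs_for (I := fun l s => imem s 1 0 = k /\ scan_inv k l s)) => //.
- by move=> i iL; apply: leq_trans bL.
- by move=> i s'' [_ [[[[]]]]].
move=> l [im nm] lL /= cl [ck' [rd lin hin le sm]].
have [[[EK EL EN] EX EM [E1 E2] Et] EJ] := rd.
rewrite /= in EK EL EN EX EM E1 E2 Et EJ lin hin le sm.
pose E := (EK, EL, EN, EX, EM, E1, E2, Et, ck', cl).
have [b1 b2] := cell_bound kK lL.
have [[[rx rm] r1] r2] := (rep_x kK lL, rep_mu kK lL, rep_y1 kK, rep_y2 kK).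
eapply runs_le.
apply: runs_seq; iput 0%N (k * L + l)%N E; first by [].
apply: runs_seq; nput 0%N (projection k l) E.
  by rep_all.
apply: runs_seq; nguard (projection k l) E => //.
apply: runs_seq; nguard (projection k l) E => //.
nput 0%N (nm 5%N 0%N + base_term k l) E.
- have rb := rep_base_term kK lL.
  have rs : repr 4 10 (nm 5%N 0%N).
    rewrite sm; have r3 := rep_base_rows (ltnW kK).
    by have r4 := rep_base_row kK (ltnW lL); rep_auto.
  rewrite -/(base_term k l); have r3 := rep_t.
  by rep_all.
- split; first exact: cl; split; first exact: ck'.
  rewrite /scan_inv /upd /=; split=> //.
  + by case: ifP => _ //; exists k, l.
  + by case: ifP => _ //; exists k, l.
  + move=> k' l' k'K l'L; rewrite ltnS [(l' <= l)%N]leq_eqVlt.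
    have [-> /=|kk] := eqVneq k' k; last first.
      rewrite andFb orbF => k'k.
      have /andP[h1 h2] : nm 6%N 0%N <= projection k' l' <= nm 7%N 0%N.
        by apply: le => //; rewrite k'k.
      apply/andP; split; case: ifP => // h; first exact: le_trans (ltW h) h1.
      exact: le_trans h2 (ltW h).
    rewrite ltnn /= => /orP[/eqP ->|l'l].
      by apply/andP; split; case: ifP => // /negbT; rewrite -leNgt.
    have /andP[h1 h2] : nm 6%N 0%N <= projection k l' <= nm 7%N 0%N.
      by apply: le => //; rewrite eqxx l'l orbT.
    apply/andP; split; case: ifP => // h; first exact: le_trans (ltW h) h1.
    exact: le_trans h2 (ltW h).
  + by rewrite sm big_ord_recr /= addrA.
- by [].
Qed.

(** A stored projection that bounds all projections is an end point of the
    grid. *)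
Lemma scan_found s : scan_inv K 0 s ->
  [/\ ready s, nmem s 6 0 = lo, nmem s 7 0 = hi & nmem s 5 0 = base_cost].
Proof.
move=> [rd [k1 [l1 [k1K l1L e1]]] [k2 [l2 [k2K l2L e2]]] le sm].
split=> //; last by rewrite sm big_ord0 addr0.
- have [k [l [kK lL elo]]] := lo_in.
  apply/eqP; rewrite eq_le {1}elo e1 lo_le // andbT -e1.
  by have /andP[] : nmem s 6 0 <= projection k l <= nmem s 7 0
    by apply: le; rewrite ?kK.
- have [k [l [kK lL ehi]]] := hi_in.
  apply/eqP; rewrite eq_le {1}e2 hi_ge //= ehi.
  by have /andP[] : nmem s 6 0 <= projection k l <= nmem s 7 0
    by apply: le; rewrite ?kK.
Qed.

Definition scanned (s : state R) : Prop :=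
  [/\ ready s, nmem s 6 0 = lo, nmem s 7 0 = hi & nmem s 5 0 = base_cost].

Definition spaced (s : state R) : Prop :=
  [/\ ready s, nmem s 6 0 = lo & nmem s 9 0 = spacing].

Lemma runs_find_step s : scanned s ->
  runs ok find_step s (N * 3 + 10)
    (fun s' => spaced s' /\ nmem s' 5 0 = base_cost).
Proof.
case: s => im nm [rd /= Elo Ehi Ebase].
have [bJ [bN [bK bL]]] := len_bound.
eapply runs_le.
apply: runs_seq; nput 0%N (0 : R) tt => //.
apply: runs_seq; apply: runs_post.
  apply: (runs_for (n := N) (c := 1)
    (I := fun n s => scanned s /\ nmem s 8 0 = n%:R)) => //.
  - by move=> i iN; apply: leq_trans bN.
  - by move=> i s' [[[[[]]]]].
  move=> i [im' nm'] iN /= ci [[rd' Elo' Ehi' Ebase'] Ec]; rewrite /= in Ec.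
  nput 0%N (i%:R + 1 : R) Ec.
    have rc := @rep_count i.+1 iN; rewrite natr1.
    by rep_all.
  by split=> //; split=> //; rewrite /= /upd /= natr1.
move=> [im' nm'] [[rd' Elo' Ehi' Ebase'] Ec]; rewrite /= in Ec Elo' Ehi' Ebase'.
have [rl rh] := (rep_lo, rep_hi).
apply: runs_seq; nput 0%N (hi - lo) (Elo', Ehi'); first by rep_all.
apply: (@runs_if _ _ _ _ _ _ (1 < N)%N [:: Truth (1 < N)%N] 2).
- by rewrite /= /upd /= Ec ltr1n.
- by [].
- move=> N1; have nz : (N%:R - 1 == 0 :> R) = false.
    by apply/negbTE; rewrite subr_eq0 pnatr_eq1; lia.
  nput 0%N ((hi - lo) / (N%:R - 1)) (Ec, nz).
    have rc := rep_count (leqnn N); have rs := rep_spacing.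
    by rewrite /spacing N1 in rs; rep_all.
  by rewrite /spaced /upd /= /spacing N1.
- move=> N1; apply: (@runs_le _ _ _ _ 0) => //; apply: runs_skip.
  by rewrite /spaced /upd /= /spacing (negbTE N1).
- by rewrite /=; lia.
Qed.

Definition started (s : state R) : Prop :=
  [/\ spaced s, nmem s 5 0 = base_cost,
      forall j, (j < K * N)%N -> nmem s 13 j = conv 0 j & nmem s 14 0 = 0].

Lemma runs_start s : spaced s /\ nmem s 5 0 = base_cost ->
  runs ok start s (K * N * 2 + 1) started.
Proof.
move=> I0; have [bJ [bN [bK bL]]] := len_bound.
eapply runs_le.
apply: runs_seq; apply: runs_post.
  apply: (runs_for (n := K * N) (c := 0) (I := fun j s =>
    [/\ spaced s, nmem s 5 0 = base_cost &
        forall i, (i < j)%N -> nmem s 13 i = 0])) => //.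
  - by move=> i iJ; apply: leq_trans bJ.
  - by move=> i s' [[[]]].
  - by case: I0.
  move=> j [im nm] jJ /= cj [sp Eb H]; rewrite /= in H.
  nput j (0 : R) cj => //.
  split=> //; split=> // i; rewrite ltnS /upd /= => ij.
  by case: eqP => //= /eqP ij'; apply: H; rewrite ltn_neqAle ij'.
move=> [im nm] [sp Eb H]; rewrite /= in H.
apply: runs_seq; nput 0%N (1 : R) tt => //.
nput 0%N (0 : R) tt => //.
  split=> // j jJ; rewrite /upd /=.
  by case: eqP => //= _; rewrite H.
by rewrite /=; lia.
Qed.

Definition collect_inv (k : nat) (s : state R) : Prop :=
  [/\ spaced s, nmem s 5 0 = base_cost,
      forall j, (j < K * N)%N -> nmem s 13 (k * (K * N) + j)%N = conv k j
    & nmem s 14 0 = lo *+ k].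

Lemma runs_collect k s : (k < K)%N -> collect_inv k s -> imem s 1 0 = k ->
  runs ok collect s (N * (L * 12 + 4) + 1) (fun s' =>
    [/\ collect_inv k s', imem s' 1 0 = k
      & forall n, (n < N)%N -> nmem s' 12 n = mass k n]).
Proof.
move=> kK; case: s => im nm ci /= ck; have [bJ [bN [bK bL]]] := len_bound.
have [[_ Elo _] _ _ _] := ci; rewrite /= in Elo.
eapply runs_le.
apply: runs_seq; nput 0%N lo Elo => //.
apply: runs_post.
  apply: (runs_for (n := N) (c := (L * (10 + 2) + 1) + 1) (I := fun n s =>
    [/\ collect_inv k s, imem s 1 0 = k, nmem s 10 0 = grid n &
        forall i, (i < n)%N -> nmem s 12 i = mass k i])) => //.
  - by move=> i iN; apply: leq_trans bN.
  - by move=> i s' [[[[[[]]]]]].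
  - by split=> //; rewrite /grid mulr0n addr0.
  move=> n [im' nm'] nN /= cn [ci' ck' Eg H]; rewrite /= in Eg H.
  eapply runs_le.
  apply: runs_seq; nput 0%N (0 : R) tt => //.
  apply: runs_seq; apply: runs_post.
    apply: (runs_for (n := L) (c := 10) (I := fun l s =>
      [/\ [/\ collect_inv k s, imem s 1 0 = k & imem s 3 0 = n],
          nmem s 10 0 = grid n, forall i, (i < n)%N -> nmem s 12 i = mass k i
        & nmem s 11 0 =
          \sum_(l' < l | projection k l' == grid n) Mu (k * L + l')%N])) => //.
    - by move=> i iL; apply: leq_trans bL.
    - by move=> i s' [[[[[[[]]]]]]].
    - by split=> //; rewrite big_ord0.
    move=> l [im2 nm2] lL /= cl [[ci2 ck2 cn2] Eg2 H2 Ea].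
    rewrite /= in ck2 cn2 Eg2 H2 Ea.
    have [[[[[EK EL EN] EX EM [E1 E2] Et] EJ] Elo2 Es] _ _ _] := ci2.
    rewrite /= in EK EL EN EX EM E1 E2 Et EJ Elo2 Es.
    pose E := (EK, EL, EN, EX, EM, E1, E2, Et, (ck2, cn2, cl, Eg2)).
    have [b1 b2] := cell_bound kK lL.
    have [[[rx rm] r1] r2] := (rep_x kK lL, rep_mu kK lL, rep_y1 kK, rep_y2 kK).
    eapply runs_le.
    apply: runs_seq; iput 0%N (k * L + l)%N E; first by [].
    apply: runs_seq; nput 0%N (projection k l) E; first by rep_all.
    apply: (@runs_if _ _ _ _ _ _ (projection k l <= grid n)
      [:: Truth (projection k l <= grid n)] 2).
    + by rewrite /= /upd /= Eg2.
    + by [].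
    + move=> le1; nguard (nm2 11%N 0%N + Mu (k * L + l)%N) E; [by []| |].
        move=> _; rewrite Ea; have rs := rep_mass_part n kK (ltnW lL).
        by rep_all.
      split; first exact: cl; split=> //; rewrite /upd /=.
      rewrite (big_ord_recr_cond _ (fun l => projection k l == grid n)
        (fun l => Mu (k * L + l)%N)).
      by rewrite eq_le le1 /= Ea; case: ifP => // _; rewrite addr0.
    + move=> le1; apply: (@runs_le _ _ _ _ 0) => //; apply: runs_skip.
      split; first exact: cl; split=> //; rewrite /upd /=.
      rewrite (big_ord_recr_cond _ (fun l => projection k l == grid n)
        (fun l => Mu (k * L + l)%N)).
      by rewrite eq_le (negbTE le1) /= addr0.
    + by [].
  move=> [im2 nm2] [[ci2 ck2 cn2] Eg2 H2 Ea]; rewrite /= in ck2 cn2 Eg2 H2 Ea.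
  have [[_ _ Es] _ _ _] := ci2; rewrite /= in Es.
  apply: runs_seq; nput n (mass k n) (cn2, Ea); first by [].
  nput 0%N (grid n + spacing) (Eg2, Es).
  - have rg := rep_grid nN; have rs := rep_spacing; rep_all.
  - split; first exact: cn2; split=> //; rewrite /upd /=.
      by rewrite /grid mulrSr addrA.
    by move=> i; rewrite ltnS; case: eqP => [->|/eqP ne] //= ie; apply: H2; lia.
  - by rewrite /=; lia.
- by move=> s' [ci' ck' _ H].
- by rewrite /=; lia.
Qed.

Lemma runs_convolve k s : (k < K)%N ->
  [/\ collect_inv k s, imem s 1 0 = k
      & forall n, (n < N)%N -> nmem s 12 n = mass k n] ->
  runs ok convolve s (K * N * (N * 10 + 6) + 1) (fun s' =>
    [/\ collect_inv k s', imem s' 1 0 = k &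
      forall j, (j < K * N)%N -> nmem s' 13 (k.+1 * (K * N) + j)%N = conv k.+1 j]).
Proof.
move=> kK [ci ck Hm]; have [bJ [bN [bK bL]]] := len_bound.
apply: runs_le.
apply: runs_post.
  apply: (runs_for (n := K * N) (c := N * (8 + 2) + 1 + 3) (I := fun j s =>
    [/\ collect_inv k s, imem s 1 0 = k,
        forall n, (n < N)%N -> nmem s 12 n = mass k n &
        forall i, (i < j)%N -> nmem s 13 (k.+1 * (K * N) + i)%N = conv k.+1 i])) => //.
  - by move=> i iJ; apply: leq_trans bJ.
  - by move=> i s' [[[[]]]].
  move=> j [im nm] jJ /= cj [ci' ck' Hm' H]; rewrite /= in Hm' H.
  eapply runs_le.
  apply: runs_seq; nput 0%N (0 : R) tt => //.
  apply: runs_seq; apply: runs_post.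
    apply: (runs_for (n := N) (c := 8) (I := fun n s =>
      [/\ [/\ collect_inv k s, imem s 1 0 = k & imem s 4 0 = j],
          forall n, (n < N)%N -> nmem s 12 n = mass k n,
          forall i, (i < j)%N -> nmem s 13 (k.+1 * (K * N) + i)%N = conv k.+1 i
        & nmem s 11 0 =
          \sum_(n' < n | (n' <= j)%N) mass k n' * conv k (j - n')])) => //.
    - by move=> i iN; apply: leq_trans bN.
    - by move=> i s' [[[[[[[]]]]]]].
    - by split=> //; rewrite big_ord0.
    move=> n [im2 nm2] nN /= cn [[ci2 ck2 cj2] Hm2 H2 Ea].
    rewrite /= in ck2 cj2 Hm2 H2 Ea.
    have [[[[[EK EL EN] EX EM [E1 E2] Et] EJ] Elo2 Es] _ Hc _] := ci2.
    rewrite /= in EK EL EN EX EM E1 E2 Et EJ Elo2 Es Hc.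
    pose E := (EJ, ck2, cj2, cn, Hm2 _ nN).
    have recr := big_ord_recr_cond n (fun n => (n <= j)%N)
      (fun n => mass k n * conv k (j - n)).
    eapply runs_le.
    apply: (@runs_if _ _ _ _ _ _ (n <= j)%N [:: Truth (n <= j)%N] 5).
    + by rewrite /= cn cj2.
    + by [].
    + move=> nj.
      have Hjn : nm2 13%N (k * (K * N) + (j - n))%N = conv k (j - n).
        by apply: Hc; lia.
      nput 0%N (nm2 11%N 0%N + mass k n * conv k (j - n)) (E, Hjn).
      - have [b1 b2] := row_bound (ltnW kK) jJ.
        have b3 := leq_trans (leq_subr n j) (ltnW (leq_trans jJ bJ)).
        have b4 : (k * (K * N) + (j - n) <= index_bound)%N.
          by apply: leq_trans b2; rewrite leq_add2l leq_subr.
        have rm := rep_mass_part n kK (leqnn L).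
        have rc := rep_conv (j - n) (ltnW kK).
        have rs : repr k.+1 (3 * k).+3 (nm2 11%N 0%N).
          rewrite Ea; apply: (@rep_conv_part k j n kK (ltnW nN)).
          by move=> i; apply: rep_conv; exact: ltnW.
        by rep_all.
      - split; first exact: cn; split=> //; rewrite /upd /=.
        by rewrite recr nj Ea.
    + move=> nj; apply: (@runs_le _ _ _ _ 0) => //; apply: runs_skip.
      split; first exact: cn; split=> //; rewrite /upd /=.
      by rewrite recr (negbTE nj) addr0.
    + by [].
  move=> [im2 nm2] [[ci2 ck2 cj2] Hm2 H2 Ea].
  have [[[[[EK EL EN] EX EM [E1 E2] Et] EJ] Elo2 Es] Eb Hc Ev] := ci2.
  rewrite [imem _]/= in ck2 cj2 EK EL EN EJ.
  rewrite [nmem _]/= in EX EM E1 E2 Et Elo2 Es Ea H2 Eb Ev Hc.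
  have [b1 b2] := row_bound kK jJ.
  rewrite -addn1 in b1 b2; have b3 : (k + 1 <= index_bound)%N.
    by rewrite addn1; apply: leq_trans bK.
  nput ((k + 1) * (K * N) + j)%N (conv k.+1 j) (EJ, ck2, cj2, Ea).
  - by rep_all.
  - split; first exact: cj2; split; [|exact: ck2|exact: Hm2|].
      split=> // i iJ; rewrite /= /upd /= Hc //.
      by rewrite ifF //; apply/negbTE/eqP; rewrite mulnDl mul1n; lia.
    move=> i; rewrite ltnS /upd [nmem _]/= addn1 eqn_add2l => ij.
    by have [-> //|ne] := eqVneq i j; apply: H2; lia.
  - by rewrite /=; lia.
  by move=> s' [ci' ck' _ H].
by rewrite /=; lia.
Qed.

Lemma runs_distribution s : started s ->
  runs ok distribution s
    (K * (N * (L * 12 + 4) + K * N * (N * 10 + 6) + 5) + 1) (collect_inv K).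
Proof.
move=> [sp Eb Hc Ev]; have [bJ [bN [bK bL]]] := len_bound.
eapply runs_le.
  apply: (runs_for (n := K) (c := N * (L * 12 + 4) + K * N * (N * 10 + 6) + 3)
    (I := collect_inv)) => //.
  - by move=> i iK; apply: leq_trans bK.
  - by move=> i s' [[[[[]]]]].
  move=> k s' kK ck ci; eapply runs_le.
    apply: runs_seq; apply: runs_post (runs_collect kK ci ck) _ => s1 H.
    apply: runs_seq; apply: runs_post (runs_convolve kK H) _ => -[im nm].
    move=> [[sp' Eb' Hc' Ev'] ck' H']; rewrite [imem _]/= in ck'.
    rewrite [nmem _]/= in Ev' Eb' H'; have [_ Elo _] := sp'.
    rewrite [nmem _]/= in Elo.
    nput 0%N (lo *+ k + lo) (Ev', Elo).
      have := rep_level kK (leq0n (K * N)); rewrite mulr0n addr0 mulrSr => rl.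
      by split=> //; apply: (rep_w rl); lia.
    split; first exact: ck'.
    by split=> //; rewrite /upd /= mulrSr.
  by rewrite /=; lia.
by rewrite /=; lia.
Qed.

Definition greedy_inv (j : nat) (s : state R) : Prop :=
  [/\ spaced s,
      forall i, (i < K * N)%N -> nmem s 13 (K * (K * N) + i)%N = conv K i,
      nmem s 14 0 = level j, nmem s 15 0 = rest j
    & nmem s 5 0 = base_cost + \sum_(i < j) fill i * (level i + level i)].

Lemma runs_greedy s : collect_inv K s ->
  runs ok greedy s (K * N * 12 + 2) (fun s' => output s' = value).
Proof.
case: s => im nm ci; have [bJ [bN [bK bL]]] := len_bound.
have [sp Eb Hc Ev] := ci; have [[[_ _ _ _ Et] _] _ _] := sp.
rewrite [nmem _]/= in Et Eb Hc Ev.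
eapply runs_le.
apply: runs_seq; nput 0%N (1 - t) Et.
  by have rt := rep_t; rep_all.
apply: runs_post.
  apply: (runs_for (n := K * N) (c := 10) (I := greedy_inv)) => //.
  - by move=> i iJ; apply: leq_trans bJ.
  - by move=> i s' [[[]]].
  - split=> //; first by rewrite /upd /= Ev /level mulr0n addr0.
    by rewrite big_ord0 addr0.
  move=> j [im' nm'] jJ cj [sp' Hc' Ev' Er' Eo'].
  have [[[[EK EL EN] _ _ _ _] EJ] _ Es] := sp'.
  rewrite [imem _]/= in cj EK EL EN EJ.
  rewrite [nmem _]/= in Es Hc' Ev' Er' Eo'.
  have [b1 b2] := row_bound (leqnn K) jJ.
  have rr := rep_rest j; have rf := rep_fill j.
  have rl : repr 3 6 (level j) by apply: rep_level => //; exact: ltnW.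
  eapply runs_le.
  apply: runs_seq; nput 0%N (conv K j) (EK, EJ, cj, Hc' _ jJ); first by rep_all.
  apply: runs_seq; nguard (rest j) Er'; [by []|by []|].
  apply: runs_seq.
  nput 0%N (nm' 5%N 0%N + fill j * (level j + level j)) (Er', Ev').
  - rewrite -[if _ then _ else _]/(fill j).
    have rs : repr (K + 3) (3 * K + K * N + 11) (nm' 5%N 0%N).
      have rb := rep_base_rows (leqnn K); have rfs := rep_fills (ltnW jJ).
      by rewrite Eo' /base_cost; rep_auto.
    by rep_all.
  apply: runs_seq; nput 0%N (rest j - fill j) Er'; first by rep_all.
  nput 0%N (level j + spacing) (Ev', Es).
  - by have rs := rep_spacing; rep_all.
  - split; first exact: cj; split=> //; rewrite /upd /=.
      by rewrite /level mulrSr addrA.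
    by rewrite Eo' big_ord_recr [base_cost + (_ + _)]addrA.
  - by rewrite /=; lia.
- by move=> s' [].
- by rewrite /=; lia.
Qed.

Definition cost_bound : nat :=
  (20 + K * (L * 22 + 3) + N * 3 + 10 + K * N * 2
   + K * (N * (L * 12 + 4) + K * N * (N * 10 + 6) + 5) + K * N * 12 + 5)%N.

Lemma runs_algorithm s : has_inputs s ->
  runs ok algorithm s cost_bound (fun s' => output s' = value).
Proof.
move=> hi_s; eapply runs_le.
  apply: runs_seq; apply: runs_post (runs_prepare hi_s) _ => s1.
  move=> [rd E5 E6 E7].
  have I0 : scan_inv 0 0 s1.
    split=> //; [by exists 0%N, 0%N|by exists 0%N, 0%N| |].
    - by move=> k l _ _; rewrite !ltn0 andbF.
    - by rewrite E5 !big_ord0 addr0.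
  apply: runs_seq; apply: runs_post (runs_scan I0) _ => s2 /scan_found S2.
  apply: runs_seq; apply: runs_post (runs_find_step S2) _ => s3 S3.
  apply: runs_seq; apply: runs_post (runs_start S3) _ => s4 S4.
  apply: runs_seq; apply: runs_post (runs_distribution S4) _ => s5 S5.
  exact: runs_greedy S5.
by rewrite /cost_bound; lia.
Qed.

(** * The law of the score *)

Hypothesis on_grid : forall k l, (k < K)%N -> (l < L)%N ->
  exists2 n, (n < N)%N & projection k l = grid n.
Hypothesis grid_inj : forall m n, (m < N)%N -> (n < N)%N ->
  grid m = grid n -> m = n.
Hypothesis Mu_ge0 : forall k l, (k < K)%N -> (l < L)%N ->
  0 <= Mu (k * L + l)%N.
Hypothesis Mu_sum1 : forall k, (k < K)%N -> \sum_(l < L) Mu (k * L + l)%N = 1.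
Hypothesis t01 : 0 <= t <= 1.
Hypothesis spacing_ge0 : 0 <= spacing.

Definition grid_index (k l : nat) : nat :=
  find (fun n => projection k l == grid n) (iota 0 N).

Lemma grid_indexP k l : (k < K)%N -> (l < L)%N ->
  (grid_index k l < N)%N /\ projection k l = grid (grid_index k l).
Proof.
move=> kK lL; have [n nN e] := on_grid kK lL.
have h : has (fun n => projection k l == grid n) (iota 0 N).
  by apply/hasP; exists n; rewrite ?mem_iota ?e.
have lt := h; rewrite has_find size_iota in lt.
by split=> //; have /eqP := nth_find 0%N h; rewrite nth_iota.
Qed.

(** The generating polynomial of the position of coordinate [k] on the grid. *)
Definition gen (k : nat) : {poly R} :=
  \sum_(l < L) Mu (k * L + l)%N *: 'X^(grid_index k l).

Lemma coef_gen k n : (k < K)%N ->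
  (gen k)`_n = if (n < N)%N then mass k n else 0.
Proof.
move=> kK; rewrite /gen coef_sum /mass.
under eq_bigr do rewrite coefZ coefXn.
case: ltnP => nN; last first.
  rewrite big1 // => l _; have [lt _] := grid_indexP kK (ltn_ord l).
  by rewrite gtn_eqF ?mulr0 //; exact: leq_trans nN.
rewrite [RHS]big_mkcond; apply: eq_bigr => l _.
have [lt ->] := grid_indexP kK (ltn_ord l).
have [->|ne] := eqVneq n (grid_index k l); first by rewrite eqxx mulr1.
case: eqP => [/grid_inj e|]; last by rewrite mulr0.
by rewrite e ?eqxx in ne.
Qed.

(** Convolution of laws is multiplication of generating polynomials. *)
Lemma conv_coef k j : (k <= K)%N -> conv k j = (\prod_(i < k) gen i)`_j.
Proof.
elim: k j => [|k IH] j kK; first by rewrite big_ord0 coef1.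
rewrite big_ord_recr coefMr /=.
pose F n := if (n < N)%N then mass k n * conv k (j - n) else 0.
transitivity (\sum_(n < j.+1) F n).
  rewrite (big_ord_widen_cond (N + j.+1)%N (fun n => n <= j)%N
    (fun n => mass k n * conv k (j - n)) (leq_addr _ _)).
  rewrite (big_ord_widen (N + j.+1)%N F (leq_addl _ _)).
  rewrite big_mkcond [RHS]big_mkcond; apply: eq_bigr => n _.
  by rewrite /F ltnS; case: (n <= j)%N; case: (n < N)%N.
apply: eq_bigr => n _; rewrite coef_gen // -IH ?(ltnW kK) // /F.
by case: ifP; rewrite ?mulr0 // mulrC.
Qed.

Local Notation outcome := {ffun 'I_K -> 'I_L}.

Definition prob (i : outcome) : R := \prod_(k < K) Mu (k * L + i k)%N.
Definition rank (i : outcome) : nat := \sum_(k < K) grid_index k (i k).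

(** Expanding the product of the generating polynomials gives one monomial per
    outcome. *)
Lemma conv_prob j : conv K j = \sum_(i | rank i == j) prob i.
Proof.
rewrite conv_coef // /gen bigA_distr_bigA /= coef_sum [RHS]big_mkcond.
apply: eq_bigr => i _; rewrite scaler_prod prodrXr coefZ coefXn eq_sym.
by rewrite -/(rank i) -/(prob i); case: eqP; rewrite ?mulr1 ?mulr0.
Qed.

Lemma rank_lt i : (rank i < K * N)%N.
Proof.
have : (rank i <= \sum_(k < K) N.-1)%N.
  apply: leq_sum => k _.
  by have [] := grid_indexP (ltn_ord k) (ltn_ord (i k)); lia.
rewrite sum_nat_const card_ord => h; apply: (leq_ltn_trans h).
by rewrite ltn_pmul2l //; lia.
Qed.

Lemma sum_by_rank (F : outcome -> R) :
  \sum_i F i = \sum_(j < K * N) \sum_(i | rank i == j) F i.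
Proof.
by rewrite (partition_big (fun i => Ordinal (rank_lt i)) xpredT).
Qed.

Lemma prob_ge0 i : 0 <= prob i.
Proof. by apply: prodr_ge0 => k _; apply: Mu_ge0. Qed.

(** Under a product measure a sum of functions of single coordinates integrates
    coordinate by coordinate, since the other factors sum to 1. *)
Lemma sum_prob_coord (h : 'I_K -> 'I_L -> R) :
  \sum_i prob i * (\sum_(k < K) h k (i k)) =
  \sum_(k < K) \sum_(l < L) Mu (k * L + l)%N * h k l.
Proof.
under eq_bigr do rewrite mulr_sumr.
rewrite exchange_big /=; apply: eq_bigr => k _.
pose g (k' : 'I_K) (l : 'I_L) := Mu (k' * L + l)%N * (if k' == k then h k l else 1).
transitivity (\sum_(i : outcome) \prod_k' g k' (i k')).
  apply: eq_bigr => i _; rewrite /g big_split /=; congr (_ * _).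
  by rewrite -big_mkcond big_pred1_eq.
rewrite -bigA_distr_bigA (bigD1 k) //= [X in _ * X]big1 ?mulr1.
  by apply: eq_bigr => l _; rewrite /g eqxx.
move=> k' ne; rewrite /g (negbTE ne).
by under eq_bigr do rewrite mulr1; exact: Mu_sum1.
Qed.

Lemma sum_prob : \sum_i prob i = 1.
Proof.
rewrite /prob -(bigA_distr_bigA (fun (k : 'I_K) (l : 'I_L) => Mu (k * L + l)%N)) big1 // => k _.
exact: Mu_sum1.
Qed.

Lemma conv_ge0 j : 0 <= conv K j.
Proof. by rewrite conv_prob sumr_ge0 // => i _; exact: prob_ge0. Qed.

Lemma sum_conv : \sum_(j < K * N) conv K j = 1.
Proof.
by rewrite -sum_prob sum_by_rank; apply: eq_bigr => j _; rewrite conv_prob.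
Qed.

Lemma score_level (i : outcome) :
  \sum_(k < K) projection k (i k) = level (rank i).
Proof.
rewrite /level /rank -sumrMnr -[X in lo *+ X]card_ord -sumr_const -big_split /=.
apply: eq_bigr => k _.
by have [_ ->] := grid_indexP (ltn_ord k) (ltn_ord (i k)).
Qed.

(** * Greedy filling *)

Lemma rest_ge0 j : 0 <= rest j.
Proof.
elim: j => [|j IH] /=; first by rewrite subr_ge0; case/andP: t01.
by rewrite subr_ge0 ge_min lexx.
Qed.

Lemma fill_ge0 j : 0 <= fill j.
Proof. by rewrite le_min rest_ge0 conv_ge0. Qed.

Lemma fill_le j : fill j <= conv K j.
Proof. by rewrite ge_min lexx orbT. Qed.

Lemma sum_fill j : \sum_(i < j) fill i = 1 - t - rest j.
Proof.
elim: j => [|j IH]; first by rewrite big_ord0 /= subrr.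
by rewrite big_ord_recr /= IH -/(fill j); ring.
Qed.

Lemma rest0_fill j : rest j = 0 -> fill j = 0.
Proof.
by move=> e; apply: le_anti; rewrite fill_ge0 andbT -[leRHS]e ge_min lexx.
Qed.

Lemma rest0_later j m : rest j = 0 -> rest (m + j) = 0.
Proof.
move=> r0; elim: m => [//|m IH]; rewrite addSn /= IH.
by rewrite -[Num.min _ _]/(Num.min 0 (conv K (m + j))) min_l ?subrr ?conv_ge0.
Qed.

Lemma rest_pos_fill j : rest j.+1 != 0 -> fill j = conv K j.
Proof.
rewrite /= /fill /Num.min; case: ifP => // _; by rewrite subrr eqxx.
Qed.

(** Either the supply has run out or every level so far is full; in the latter
    case the levels hold mass 1 in the end, which is at least the supply. *)
Lemma rest_end : rest (K * N) = 0.
Proof.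
have h j : rest j = 0 \/ \sum_(i < j) fill i = \sum_(i < j) conv K i.
  elim: j => [|j [r0|IH]]; first by right; rewrite !big_ord0.
    by left; exact: (rest0_later 1 r0).
  have [r0|r0] := eqVneq (rest j.+1) 0; [by left|right].
  by rewrite !big_ord_recr /= IH rest_pos_fill.
have [//|e] := h (K * N)%N.
apply: le_anti; rewrite rest_ge0 andbT.
move: e; rewrite sum_fill sum_conv => e.
by have /andP[t0 _] := t01; lra.
Qed.

(** Filling the lowest levels first is optimal: with [v] the level at which the
    supply runs out, everything below [v] is full and everything above is
    empty, so [(fill j - a j) * (level j - v)] is never positive. *)
Lemma greedy_optimal (a : nat -> R) :
  (forall j, (j < K * N)%N -> 0 <= a j <= conv K j) ->
  \sum_(j < K * N) a j = 1 - t ->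
  \sum_(j < K * N) fill j * level j <= \sum_(j < K * N) a j * level j.
Proof.
move=> ab asum.
have ex : exists j, rest j.+1 == 0.
  by exists (K * N).-1; rewrite prednK ?muln_gt0 ?K0 // rest_end.
case: (ex_minnP ex) => m /eqP rm mmin.
rewrite -subr_ge0 -sumrB.
have -> : \sum_(j < K * N) (a j * level j - fill j * level j) =
    \sum_(j < K * N) (a j - fill j) * (level j - level m).
  have e0 : (\sum_(j < K * N) (a j - fill j)) * level m = 0.
    by rewrite sumrB asum sum_fill rest_end subr0 subrr mul0r.
  apply/eqP; rewrite -subr_eq0 -[X in _ == X]e0 mulr_suml -sumrB; apply/eqP.
  by apply: eq_bigr => j _; ring.
have level_le i j : (i <= j)%N -> level i <= level j.
  by move=> ij; rewrite lerD2l ler_wpMn2l.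
apply: sumr_ge0 => j _; have /andP[a0 ac] := ab j (ltn_ord j).
case: (ltngtP j m) => [jm|mj|->]; last by rewrite subrr mulr0.
- rewrite mulr_le0 // subr_le0; last exact/level_le/ltnW.
  rewrite rest_pos_fill //; apply/negP => /mmin; lia.
- rewrite mulr_ge0 // subr_ge0; last exact/level_le/ltnW.
  by rewrite rest0_fill // -(subnK mj); exact: rest0_later.
Qed.

(** * From fillings to couplings *)

Definition sq_dist (Y : nat -> R) (i : outcome) : R :=
  \sum_(k < K) (X (k * L + i k)%N - Y k) ^+ 2.

(** The cost of sending the part [a] of the mass to [Y2] and the rest to [Y1]
    depends on [a] only through the scores. *)
Lemma split_cost (a : outcome -> R) : \sum_i a i = 1 - t ->
  \sum_i (sq_dist Y1 i * (prob i - a i) + sq_dist Y2 i * a i) =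
  base_cost + \sum_i a i * level (rank i) *+ 2.
Proof.
move=> asum.
pose c := \sum_(k < K) (Y2 k * Y2 k - Y1 k * Y1 k).
have diff i : sq_dist Y2 i = sq_dist Y1 i + (c + level (rank i) *+ 2).
  rewrite -score_level /c /sq_dist -sumrMnl -!big_split /=.
  by apply: eq_bigr => k _; rewrite /projection; ring.
have -> : base_cost = \sum_i prob i * sq_dist Y1 i + (1 - t) * c.
  rewrite /base_cost /sq_dist
    (sum_prob_coord (fun (k : 'I_K) (l : 'I_L) => (X (k * L + l)%N - Y1 k) ^+ 2)).
  rewrite /c mulr_sumr -big_split /=; apply: eq_bigr => k _.
  rewrite -[X in _ + X]mul1r -[X in X * _](Mu_sum1 (ltn_ord k)) mulr_suml.
  rewrite -big_split /=.
  by apply: eq_bigr => l _; rewrite /base_term; ring.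
rewrite -asum mulr_suml -!big_split /=; apply: eq_bigr => i _.
by rewrite diff; ring.
Qed.

Lemma sum_by_level (a : outcome -> R) :
  \sum_i a i * level (rank i) *+ 2 =
  (\sum_(j < K * N) (\sum_(i | rank i == j) a i) * level j) *+ 2.
Proof.
rewrite -sumrMnl sum_by_rank; apply: eq_bigr => j _.
by rewrite mulr_suml -sumrMnl; apply: eq_bigr => i /eqP ->.
Qed.

Lemma valueE : value = base_cost + (\sum_(j < K * N) fill j * level j) *+ 2.
Proof.
by congr (_ + _); rewrite -sumrMnl; apply: eq_bigr => j _; ring.
Qed.

Lemma value_le (a : outcome -> R) : (forall i, 0 <= a i <= prob i) ->
  \sum_i a i = 1 - t ->
  value <= \sum_i (sq_dist Y1 i * (prob i - a i) + sq_dist Y2 i * a i).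
Proof.
move=> ab asum; rewrite split_cost // sum_by_level valueE lerD2l ler_wMn2r //.
apply: (greedy_optimal (a := fun j => \sum_(i | rank i == j) a i)).
  move=> j _; rewrite conv_prob sumr_ge0 ?ler_sum // => i _;
    by case/andP: (ab i).
by rewrite -asum [RHS]sum_by_rank.
Qed.

(** Each level set is split in the ratio prescribed by the greedy filling. *)
Definition greedy_part (i : outcome) : R :=
  prob i * (fill (rank i) / conv K (rank i)).

Lemma greedy_part_sum j : \sum_(i | rank i == j) greedy_part i = fill j.
Proof.
rewrite (eq_bigr (fun i => prob i * (fill j / conv K j))); last first.
  by move=> i /eqP <-.
rewrite -mulr_suml -conv_prob.
have [c0|c0] := eqVneq (conv K j) 0; last by field.
rewrite c0 mul0r; apply: le_anti; rewrite fill_ge0 /=.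
by rewrite -c0 fill_le.
Qed.

Lemma greedy_part_bounds i : 0 <= greedy_part i <= prob i.
Proof.
rewrite /greedy_part; apply/andP; split.
  by rewrite mulr_ge0 ?prob_ge0 // divr_ge0 ?fill_ge0 ?conv_ge0.
rewrite ler_piMr ?prob_ge0 //.
have [->|c0] := eqVneq (conv K (rank i)) 0; first by rewrite invr0 mulr0.
by rewrite ler_pdivrMr ?mul1r ?fill_le // lt_def c0 conv_ge0.
Qed.

Lemma greedy_part_total : \sum_i greedy_part i = 1 - t.
Proof.
rewrite sum_by_rank (eq_bigr (fun j : 'I_(K * N) => fill j)) => [|j _].
  by rewrite sum_fill rest_end subr0.
exact: greedy_part_sum.
Qed.

Lemma value_greedy : value =
  \sum_i (sq_dist Y1 i * (prob i - greedy_part i) + sq_dist Y2 i * greedy_part i).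
Proof.
rewrite split_cost ?greedy_part_total // sum_by_level valueE.
by congr (_ + _ *+ 2); apply: eq_bigr => j _; rewrite greedy_part_sum.
Qed.

Lemma value_is_ot_distance (x mu : 'M[R]_(K, L)) (y1 y2 : 'rV[R]_K) :
  (forall (k : 'I_K) (l : 'I_L), X (k * L + l)%N = x k l) ->
  (forall (k : 'I_K) (l : 'I_L), Mu (k * L + l)%N = mu k l) ->
  (forall k : 'I_K, Y1 k = y1 0 k) -> (forall k : 'I_K, Y2 k = y2 0 k) ->
  is_ot_distance (@sq_cost R K) (product_dist (marginal x mu))
    (two_point_dist t y1 y2) value.
Proof.
move=> xE muE y1E y2E; set P := product_dist _; set T := two_point_dist _ _ _.
have wE i : weight P i = prob i by apply: eq_bigr => k _; rewrite muE.
have cE (Y : nat -> R) (y : 'rV[R]_K) i :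
    (forall k : 'I_K, Y k = y 0 k) -> sq_cost (atom P i) y = sq_dist Y i.
  move=> YE; rewrite /sq_cost /euclidean_norm sqr_sqrtr.
    by apply: eq_bigr => k _; rewrite !mxE YE xE.
  by apply: sumr_ge0 => k _; rewrite sqr_ge0.
have costE p : transport_cost (@sq_cost R K) P T p =
    \sum_i (sq_dist Y1 i * p i true + sq_dist Y2 i * p i false).
  by apply: eq_bigr => i _; rewrite big_bool /= (cE Y1) // (cE Y2).
split.
  exists (fun i b => if b then prob i - greedy_part i else greedy_part i).
    split.
    - move=> i []; have /andP[g0 gp] := greedy_part_bounds i => //.
      by rewrite subr_ge0.
    - by move=> i; rewrite wE big_bool /= subrK.
    - case=> /=; last exact: greedy_part_total.
      by rewrite sumrB sum_prob greedy_part_total; ring.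
  by rewrite costE -value_greedy.
move=> _ [p [p0 prow pcol] <-]; rewrite costE.
have rowE i : p i true = prob i - p i false.
  by rewrite -wE -prow big_bool /= addrK.
under eq_bigr do rewrite rowE.
apply: value_le; last exact: (pcol false).
by move=> i; rewrite p0 /= -subr_ge0 -rowE p0.
Qed.

End Values.

(** * Bit lengths and operation count *)

Section BitLengths.
Variables (R : realType) (K L N : nat) (X Mu Y1 Y2 : nat -> R) (t : R) (U : nat).
Hypotheses (K0 : (0 < K)%N) (L0 : (0 < L)%N) (N0 : (0 < N)%N) (U0 : (0 < U)%N).
Hypothesis dataU :
  forall u, datum K L X Mu Y1 Y2 t u -> ratio_of_ints_le U u.

(** The data and the sizes [K], [L], [N], [K * N] are all at most [2 ^ b]. *)
Let b : nat := (K + L + N + up_log 2 U + 1)%N.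

Lemma leq_exp2_b n m : (n <= 2 ^ m)%N -> (m <= b)%N -> (n <= 2 ^ b)%N.
Proof. by move=> nm mb; apply: (leq_trans nm); rewrite leq_exp2l. Qed.

Lemma ltn_exp2W n : (n <= 2 ^ n)%N.
Proof. exact/ltnW/ltn_expl. Qed.

(** There are [2 K L + 2 K + 1] data, each with a denominator of at most
    [up_log 2 U <= b] bits, and the factor [N - 1]; hence the exponent
    [5 b ^ 3 + b <= 6 b ^ 3]. *)
Lemma common_scale : exists Q : nat,
  (Q <= 2 ^ (6 * b ^ 3))%N /\ scale K L N X Mu Y1 Y2 t Q (2 ^ b).
Proof.
pose f (i : (('I_K * 'I_L) + ('I_K * 'I_L)) + (('I_K + 'I_K) + unit)) : R :=
  match i with
  | inl (inl kl) => X (kl.1 * L + kl.2)%N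
  | inl (inr kl) => Mu (kl.1 * L + kl.2)%N
  | inr (inl (inl k)) => Y1 k
  | inr (inl (inr k)) => Y2 k
  | inr (inr _) => t
  end.
have fU i : ratio_of_ints_le U (f i).
  apply: dataU; rewrite /datum; case: i => [[[k l]|[k l]]|[[k|k]|[]]] /=.
  - by left; exists k, l; split=> //; left.
  - by left; exists k, l; split=> //; right.
  - by right; left; exists k => //; left.
  - by right; left; exists k => //; right.
  - by right; right.
have [Q [Q0 QU fQ]] := common_denominator fU.
have UE : (U <= 2 ^ up_log 2 U)%N by apply: up_logP.
exists (Q * maxn 1 N.-1)%N; split.
  have c1 : (#|{: (('I_K * 'I_L) + ('I_K * 'I_L)) + (('I_K + 'I_K) + unit)}|
      = K * L + K * L + (K + K + 1))%N.
    by rewrite !card_sum !card_prod card_unit !card_ord.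
  have : (Q * maxn 1 N.-1 <=
      2 ^ (up_log 2 U * (K * L + K * L + (K + K + 1)) + N))%N.
    rewrite expnD leq_mul //; last by apply: leq_trans (ltn_exp2W N); lia.
    by rewrite expnM -c1; apply: leq_trans QU _; rewrite leq_exp2r // c1; lia.
  move/leq_trans; apply; rewrite leq_exp2l //.
  have h : forall u k l n m : nat, (u <= m -> k <= m -> l <= m -> n <= m ->
      0 < m -> u * (k * l + k * l + (k + k + 1)) + n <= 6 * m ^ 3)%N.
    move=> u k l n m um km lm nm m0.
    have kl : (k * l <= m * m)%N by apply: leq_mul.
    have mm : (m <= m * m)%N by apply: leq_pmull.
    have mmm : (m <= m * (m * m))%N by apply: leq_pmulr; rewrite muln_gt0 m0.
    have : (u * (k * l + k * l + (k + k + 1)) <= m * (5 * (m * m)))%N.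
      by apply: leq_mul => //; lia.
    rewrite !expnS expn0; lia.
  by apply: h; rewrite /b; lia.
split.
- split; first by rewrite muln_gt0 Q0; lia.
  by rewrite -[1%N](expn0 2) ltn_exp2l // /b; lia.
- by split; apply: (leq_exp2_b (ltn_exp2W _)); rewrite /b; lia.
- split; first by apply: (leq_exp2_b (ltn_exp2W _)); rewrite /b; lia.
  apply: (@leq_exp2_b _ (K + N)); last by rewrite /b; lia.
  by rewrite expnD leq_mul // ltn_exp2W.
- by move=> N1; rewrite dvdn_mull // (maxn_idPr _) //; lia.
- move=> u du; split; last first.
    apply: le_trans (ratio_norm (dataU du)) _; rewrite ler_nat.
    by apply: leq_exp2_b UE _; rewrite /b; lia.
  rewrite natrM mulrA rpredM ?natr_int //.
  case: du => [[k [l [kK lL [->|->]]]]|[[k kK [->|->]]|->]].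
  + exact: (fQ (inl (inl (Ordinal kK, Ordinal lL)))).
  + exact: (fQ (inl (inr (Ordinal kK, Ordinal lL)))).
  + exact: (fQ (inr (inl (inl (Ordinal kK))))).
  + exact: (fQ (inr (inl (inr (Ordinal kK))))).
  + exact: (fQ (inr (inr tt))).
Qed.

(** With [K + 8 <= 9 b] and [4 K + K N + 20 <= 25 b ^ 2], the numerator takes
    [(25 + 54) b ^ 4] bits and the denominator [54 b ^ 4]; three more bits are for
    the sign and for rounding up. *)
Lemma ok_bits r : ok K L N X Mu Y1 Y2 t r ->
  result_bits_le (136 * b ^ 4)%:R r.
Proof.
have b0 : (3 < b)%N by rewrite /b; lia.
have b2 : (b * b <= b ^ 4)%N by rewrite -[(b * b)%N]/(b ^ 2)%N leq_exp2l //; lia.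
have b3 : (b ^ 3 <= b ^ 4)%N by rewrite leq_exp2l //; lia.
have b1 : (b <= b * b)%N by apply: leq_pmull; lia.
have [Kb Lb Nb] : [/\ K <= b, L <= b & N <= b]%N by rewrite /b; split; lia.
case: r => [n|u|//] /=.
  rewrite /index_bound => nb; rewrite ler_nat.
  have : (nat_bits n <= n.+1)%N by apply: nat_bits_le; exact: ltn_exp2W.
  have KN : (K.+1 * (K * N) <= (2 * b) * (b * b))%N.
    by apply: leq_mul; [lia|exact: leq_mul].
  have KL : (K * L <= b * b)%N by apply: leq_mul.
  have : (b * (b * b) <= b ^ 4)%N by rewrite (leq_trans _ b3) // !expnS expn0 muln1.
  by lia.
have [Q [Qle SQ]] := common_scale => /(_ _ _ SQ) [iu bu].
have [[Q0 _] _ _ _ _] := SQ.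
set c := (K + 8)%N in iu bu *; set h := (4 * K + K * N + 20)%N in bu.
have Qc : (Q ^ c <= 2 ^ (6 * b ^ 3 * c))%N.
  by rewrite expnM leq_exp2r // /c; lia.
have Qc0 : (0 < Q ^ c)%N by rewrite expn_gt0 Q0.
have uQ : `|u * (Q ^ c)%:R| <= (2 ^ (b * h + 6 * b ^ 3 * c))%:R.
  rewrite normrM normr_nat expnD natrM ler_pM // ?ler_nat //.
  by rewrite expnM natrX.
rewrite -natrX in iu.
have [q [uq qb]] := rat_bits_le Qc0 iu uQ Qc.
exists q; split=> //; rewrite ler_nat; apply: leq_trans qb _.
have KN : (K * N <= b * b)%N by apply: leq_mul.
have bh : (b * h <= b * (25 * (b * b)))%N.
  by rewrite leq_mul2l; apply/orP; right; rewrite /h; lia.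
have bc : (6 * b ^ 3 * c <= 6 * b ^ 3 * (9 * b))%N.
  by rewrite leq_mul2l; apply/orP; right; rewrite /c; lia.
have e3 : (b ^ 3 = b * (b * b))%N by rewrite !expnS expn0 muln1.
have e4 : (b ^ 4 = b * (b * (b * b)))%N by rewrite !expnS expn0 muln1.
have bB : (b <= b * (b * (b * b)))%N by rewrite leq_pmulr // !muln_gt0; lia.
rewrite e3 e4 in bc b3 *; rewrite mulnCA in bh.
move: (b * (b * b))%N bh bc b3 bB => B bh bc b3 bB.
clearbody c h; lia.
Qed.

End BitLengths.

Lemma cost_bound_le K L N : (0 < K)%N -> (0 < L)%N -> (0 < N)%N ->
  (cost_bound K L N <= 100 * (K * L * N + K ^ 2 * N ^ 2))%N.
Proof.
move=> K0 L0 N0; rewrite /cost_bound.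
have kl : (K * L <= K * L * N)%N by apply: leq_pmulr.
have k : (K <= K * L)%N by apply: leq_pmulr.
have kn : (K * N <= K * L * N)%N by rewrite leq_mul2r k orbT.
have n : (N <= K * N)%N by apply: leq_pmull.
have kkn : (K * K * N <= K * K * N * N)%N by apply: leq_pmulr.
rewrite !expnS !expn0; lia.
Qed.

Lemma regular_gridE (R : realType) (N : nat) (G : set R) :
  regular_grid N G -> exists lo d : R, 0 < d /\
    forall z, G z <-> exists2 n, (n < N)%N & z = lo + d *+ n.
Proof.
case: N => [|N] [s [d [d0 sd ->]]].
  exists 0, d; split=> // z; split=> [[[]] //|[]] //.
have sE n (nN : (n < N.+1)%N) : s (Ordinal nN) = s ord0 + d *+ n.
  elim: n nN => [|n IH] nN.
    by rewrite mulr0n addr0; congr s; apply: val_inj.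
  by rewrite (sd (Ordinal (ltnW nN))) // IH mulrSr addrA.
exists (s ord0), d; split=> // z; split.
  by move=> [[n nN] _ <-]; exists n => //; exact: sE.
by move=> [n nN ->]; exists (Ordinal nN).
Qed.

(** * The theorem *)

(* C bounds the hidden constant of the operation count; every polynomial in
   K >= 1, L, N and log2 U is bounded by some A * (K + L + N + log2 U) ^ e. *)
Theorem theorem4p1 (R : realType) :
  exists (alg : cmd) (C A : R) (e : nat),
    forall (K L N : nat) (x mu : 'M[R]_(K, L)) (y1 y2 : 'rV[R]_K) (t : R)
           (G : set R) (s : state R),
      (0 < K)%N -> (0 < L)%N ->
      (forall k, is_prob (marginal x mu k)) ->
      0 <= t <= 1 ->
      regular_grid N G ->
      spans_grid (projections x y1 y2) G ->
      holds_input N x mu y1 y2 t s ->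
      exists (s' : state R) (tr : seq (result R)),
        [/\ exec alg s s' tr,
            is_ot_distance (@sq_cost R K) (product_dist (marginal x mu))
              (two_point_dist t y1 y2) (output s'),
            (size tr)%:R <=
              C * ((K * L)%:R * log2 (K * L)%:R + (K * L * N)%:R
                   + (K ^ 2 * N ^ 2)%:R)
          & forall U : nat,
              (forall k l, ratio_of_ints_le U (x k l)) ->
              (forall k l, ratio_of_ints_le U (mu k l)) ->
              (forall k, ratio_of_ints_le U (y1 0 k)) ->
              (forall k, ratio_of_ints_le U (y2 0 k)) ->
              ratio_of_ints_le U t ->
              all_results
                (result_bits_le (A * ((K + L + N)%:R + log2 U%:R) ^+ e)) tr].
Proof.
(* 2176 = 136 * 2 ^ 4, as the exponent b of the bit bound is at most twice the
   sum of the parameters. *)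
exists algorithm, 100, 2176, 4 => K L N x mu y1 y2 t G s K0 L0 prob_mu t01.
move=> /regular_gridE [g [d [d0 GE]]] [MG [a [[Ma lbMa] [Ga lbGa]]]].
move=> [c [[Mc ubMc] [Gc ubGc]]] [[EK EL EN] xE muE yE tE].
have N0 : (0 < N)%N by case/GE: Ga => n; case: (N).
set X := nmem s 0; set Mu := nmem s 1; set Y1 := nmem s 2; set Y2 := nmem s 3.
have ag : a = g.
  apply: le_anti; apply/andP; split.
    by apply: lbGa; apply/GE; exists 0%N; rewrite ?mulr0n ?addr0.
  by case/GE: Ga => n _ ->; rewrite lerDl mulrn_wge0 // ltW.
have cg : c = g + d *+ N.-1.
  apply: le_anti; apply/andP; split; last first.
    by apply: ubGc; apply/GE; exists N.-1; rewrite ?prednK.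
  by case/GE: Gc => n nN ->; rewrite lerD2l ler_wpMn2l ?ltW //; lia.
have projE (k : 'I_K) (l : 'I_L) :
    projection L X Y1 Y2 k l = x k l * (y1 0 k - y2 0 k).
  by rewrite /projection /X /Y1 /Y2 xE; have [-> ->] := yE k.
have Mproj k l : (k < K)%N -> (l < L)%N ->
    projections x y1 y2 (projection L X Y1 Y2 k l).
  by move=> kK lL; exists (Ordinal kK), (Ordinal lL); rewrite -projE.
have Mex z : projections x y1 y2 z ->
    exists k l, [/\ (k < K)%N, (l < L)%N & z = projection L X Y1 Y2 k l].
  by move=> [k [l ->]]; exists k, l; rewrite projE.
have spE : (1 < N)%N -> spacing N a c = d.
  move=> N1; rewrite /spacing N1 ag cg addrAC subrr add0r.
  rewrite -[X in _ - X]/(1%:R) -natrB // subn1 -[d *+ _]mulr_natr mulfK //.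
  by rewrite pnatr_eq0; lia.
have sp1 : (N <= 1)%N -> spacing N a c = 0.
  move=> N1; rewrite /spacing ltnNge N1 ag cg.
  by rewrite (_ : N.-1 = 0)%N ?mulr0n ?addr0 ?subrr //; lia.
have on_grid k l : (k < K)%N -> (l < L)%N ->
    exists2 n, (n < N)%N & projection L X Y1 Y2 k l = grid N a c n.
  move=> kK lL; have /MG/GE [n nN ->] := Mproj _ _ kK lL; exists n => //.
  rewrite /grid ag; have [N1|N1] := ltnP 1 N; first by rewrite -ag spE.
  by rewrite (_ : n = 0)%N ?mulr0n //; lia.
have grid_inj m n : (m < N)%N -> (n < N)%N -> grid N a c m = grid N a c n ->
    m = n.
  move=> mN nN; have [N1|N1] := ltnP 1 N; last by lia.
  by rewrite /grid spE // => /addrI/(mulrIn (lt0r_neq0 d0)).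
have sp0 : 0 <= spacing N a c.
  by have [N1|N1] := ltnP 1 N; [rewrite spE // ltW|rewrite sp1].
have Mu0 k l : (k < K)%N -> (l < L)%N -> 0 <= Mu (k * L + l)%N.
  move=> kK lL; rewrite /Mu (muE (Ordinal kK) (Ordinal lL)).
  by have [h _] := prob_mu (Ordinal kK); exact: h.
have Mu1 k : (k < K)%N -> \sum_(l < L) Mu (k * L + l)%N = 1.
  move=> kK; have [_ <-] := prob_mu (Ordinal kK); apply: eq_bigr => l _.
  exact: (muE (Ordinal kK) l).
have [|s' [tr [ex sz okr out_s']]] :=
    @runs_algorithm R K L N X Mu Y1 Y2 t a c K0 L0 N0 (Mex _ Ma) (Mex _ Mc)
      (fun k l kK lL => lbMa _ (Mproj k l kK lL))
      (fun k l kK lL => ubMc _ (Mproj k l kK lL)) s.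
  by split.
exists s', tr; split=> //.
- rewrite out_s'; apply: value_is_ot_distance => // k; first by have [] := yE k.
  by have [] := yE k.
- apply: (@le_trans _ _ (100 * (K * L * N + K ^ 2 * N ^ 2))%:R).
    by rewrite ler_nat (leq_trans sz) // cost_bound_le.
  rewrite natrM ler_wpM2l // natrD -addrA lerDr mulr_ge0 //.
  by apply: log2_ge0; rewrite muln_gt0 K0.
- move=> U xU muU y1U y2U tU.
  have U0 : (0 < U)%N by case: tU => p [q [q0 _ + _]]; lia.
  have dataU u : datum K L X Mu Y1 Y2 t u -> ratio_of_ints_le U u.
    case=> [[k [l [kK lL [->|->]]]]|[[k kK [->|->]]|->]] //.
    + by rewrite /X (xE (Ordinal kK) (Ordinal lL)).
    + by rewrite /Mu (muE (Ordinal kK) (Ordinal lL)).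
    + by have [e _] := yE (Ordinal kK); rewrite /Y1 e.
    + by have [_ e] := yE (Ordinal kK); rewrite /Y2 e.
  have okb r := @ok_bits R K L N X Mu Y1 Y2 t U K0 L0 N0 U0 dataU r.
  set b := (_ + _ + _ + _ + _)%N in okb.
  set T := (_ + log2 _); have T3 : 3 <= T.
    rewrite -[3]addr0 lerD ?log2_ge0 // ler_nat; lia.
  have bT : (136 * b ^ 4)%:R <= 2176 * T ^+ 4.
    have bT2 : b%:R <= 2 * T.
      have := up_log_log2 R U0; rewrite /b /T !natrD; move: T3; rewrite /T natrD natrD.
      by lra.
    have -> : 2176 * T ^+ 4 = 136 * (2 * T) ^+ 4 by ring.
    rewrite natrM natrX ler_wpM2l // lerXn2r ?nnegrE //.
    by rewrite mulr_ge0 // (le_trans _ T3).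
  elim: tr okr {ex sz} => [|r tr IH] //= [okr oktr]; split; last exact: IH.
  move: (okb r okr); case: (r) => [n|u|//] /=.
    by move=> h; apply: le_trans bT.
  by move=> [q [uq qb]]; exists q; split=> //; apply: le_trans bT.
Qed.
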